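(* Let $\Sigma=\langle\varphi_0,\dots,\varphi_n\rangle$ be a finitely generated strong tropical linear series on a metric graph $\Gamma$, let $M$ be a valuated matroid on $\{\varphi_0,\dots,\varphi_n\}$, as provided by condition (5) of the definition of strong tropical linear series, such that $\min_i\{\varphi_i+V(\varphi_i)\}$ is a tropical dependence for every valuated circuit $V$ of $M$, and let $\Phi=(\varphi_0,\dots,\varphi_n)\colon\Gamma\to\mathbb{TP}^n$, whose image is contained in $\mathcal{B}(M)$. Then there exists a tropical modification $\widetilde\Gamma$ of $\Gamma$ and a balanced map $\widetilde\Phi\colon\widetilde\Gamma\to\mathcal{B}(M)$ such that $\widetilde\Phi|_\Gamma=\Phi$.
   Context: Metric graphs and divisors. A metric graph $\Gamma$ is a compact, connected length metric space homeomorphic to a topological graph. A tangent vector $\zeta$ based at $v$ is a direction at $v$ along one of the half-open segments forming a small neighborhood of $v$. A divisor is a finite formal integer combination $D=\sum_vD(v)\,v$ of points; it is effective ($D\ge0$) if all $D(v)\ge0$; $D\ge E$ means $D-E\ge0$. $\mathrm{PL}(\Gamma)$ is the set of continuous piecewise-linear functions $\Gamma\to\mathbb{R}$ with integer slopes. $s_\zeta(\varphi)$ is the outgoing slope along $\zeta$, $\mathrm{ord}_v(\varphi)=-\sum_\zeta s_\zeta(\varphi)$ (over tangent vectors at $v$), $\mathrm{div}(\varphi)=\sum_v\mathrm{ord}_v(\varphi)\,v$, $R(D)=\{\varphi\in\mathrm{PL}(\Gamma):\mathrm{div}(\varphi)+D\ge0\}$. Tropical modules. A tropical linear combination of $\varphi_0,\dots,\varphi_k$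 is $\min_i\{\varphi_i+a_i\}$ with $a_i\in\mathbb{R}$. It is a tropical dependence if at every point of $\Gamma$ the minimum is achieved by at least two indices; a set admitting one is tropically dependent. A tropical submodule is a subset of $\mathrm{PL}(\Gamma)$ closed under tropical linear combinations; $\langle S\rangle$ is the set of tropical linear combinations of elements of $S$; $\Sigma$ is finitely generated if $\Sigma=\langle S\rangle$ with $S\subseteq\Sigma$ finite. Tropical linear series (recursive in $r\ge0$). A tropical linear series of rank $r$ is a tropical submodule $\Sigma\subseteq R(D)$ such that: (1) for every effective divisor $E$ of degree $r$ there is $\varphi\in\Sigma$ with $\mathrm{div}(\varphi)+D\ge E$; (2) every set of $r+2$ functions in $\Sigma$ is tropically dependent; (3) for each tangent vector $\zeta$ and $0\le i<r$, the set $\{\varphi\in\Sigma:s_\zeta(\varphi)\le s_\zeta[i]\}$ contains a tropical linear series of rank $i$ (a submodule of $R(D)$). Here $s_\zeta[0]<\cdots<s_\zeta[r]$ are the distinct values of $s_\zeta(\varphi)$, $\varphi\in\Sigma$; (1) and (2) imply there are exactly $r+1$. Valuated matroids. For $V\colon E\to\mathbb{R}\cup\{\infty\}$ let $\mathrm{supp}(V)=\{e:V(e)\ne\infty\}$. A valuated matroid of rank $\rho$ on a (possibly infinite) set $E$ is a collection $\mathcal{V}$ of functions $E\to\mathbb{R}\cup\{\infty\}$ (valuated circuits) with: the constant $\infty$ is not in $\mathcal{V}$; $V\in\mathcal{V}$, $a\in\mathbb{R}$ imply $V+a\in\mathcal{V}$; if $\mathrm{supp}(V_1)\ne\mathrm{supp}(V_2)$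 then $\mathrm{supp}(V_1)\not\subset\mathrm{supp}(V_2)$; $\max\{|A|:A\subseteq E,\ A\not\supseteq\mathrm{supp}(V)\ \forall V\in\mathcal{V}\}=\rho$; and if $V_1,V_2\in\mathcal{V}$, $V_1(e)=V_2(e)\ne\infty$ and $V_1(e')<V_2(e')$, there is $V\in\mathcal{V}$ with $V(e)=\infty$, $V(e')=V_1(e')$, $V\ge\min\{V_1,V_2\}$. Strong tropical linear series. A tropical linear series $\Sigma\subseteq R(D)$ of rank $r$ is strong if moreover (4) $|\Sigma|=\{\mathrm{div}(\varphi)+D:\varphi\in\Sigma\}$ is a closed and definable subset of $|D|=|R(D)|$; (5) there is a valuated matroid $\mathcal{V}$ of rank $r+1$ on the set $\Sigma$ such that for every $V\in\mathcal{V}$, $\min_{\varphi\in\Sigma}\{\varphi+V(\varphi)\}$ is a tropical dependence (among functions in $\mathrm{supp}(V)$). In (4), the topology is induced from $\mathrm{Sym}^d\Gamma$, $d=\deg D$, and definable means the following. Choose a finite vertex set containing all points of valence $\neq 2$, and identify each oriented open edge $e$ with $(0,\ell(e))$. $|D|$ decomposes into finitely many cells indexed by integers $d_v$ (vertices) and $m_e,d_e^1,\dots,d_e^{r_e}$ (edges): $D'$ is in the cell if $D'(v)=d_v$, $D'|_e=\sum_id_e^ix_i$ with $0<x_1<\cdots<x_{r_e}<\ell(e)$, and any $\varphi$ with $\mathrm{div}(\varphi)=D'-D$ has starting slope $m_e$ along $e$. Via the coordinates $x_i$ each cell is a subset of some $\mathbb{R}^N$, and a subset of $|D|$ is definable if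 its intersection with each cell is a finite Boolean combination of finite intersections of halfspaces $\{u:\langle u,v\rangle\ge a\}$, $v\in\mathbb{Z}^N$, $a\in\mathbb{R}$. Tropical projective space and linear spaces. $\mathbb{TP}^n=\big((\mathbb{R}\cup\{\infty\})^{n+1}\smallsetminus\{(\infty,\dots,\infty)\}\big)/\mathbb{R}(1,\dots,1)$. For the valuated matroid $M$ on $\{\varphi_0,\dots,\varphi_n\}$, writing $V(i)=V(\varphi_i)$, $\mathcal{B}(M)=\{x\in\mathbb{TP}^n:\min_i\{V(i)+x_i\}\text{ occurs at least twice for all valuated circuits }V\text{ of }M\}$. Tropical modification and balancing. A tropical modification of $\Gamma$ is a (possibly unbounded) graph obtained from $\Gamma$ by finitely many operations of attaching an infinite ray at a point. A map $\widetilde\Phi$ is balanced if it is continuous and, in homogeneous coordinates, piecewise linear with integer slopes, and at every point of $\widetilde\Gamma$ (other than points at infinity) the sum over all tangent directions of the outgoing slope vectors is zero in $\mathbb{R}^{n+1}/\mathbb{R}(1,\dots,1)$. *)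

(* Defs.v *)
From HB Require Import structures.
From mathcomp Require Import all_boot all_order all_algebra generic_quotient.
From mathcomp Require Import all_classical all_reals all_analysis.

Set Implicit Arguments.
Unset Strict Implicit.
Unset Printing Implicit Defensive.

Import Order.TTheory GRing.Theory Num.Theory.

Local Open Scope classical_set_scope.
Local Open Scope card_scope.
Local Open Scope ring_scope.

(** Metric graphs and their modifications are both presented as a set of points
    covered by finitely many segments [0, seg_len s], where seg_len s may be +oo
    (the segment is then [0, +oo], with a point at infinity).
    chart s t is the point at distance t from the start of s; its values at t
    outside of [0, seg_len s] are irrelevant.  All the curves used below are
    obtained from metric graphs by attaching rays, so no axiom is put here. *)
Record curve (R : realType) := Curve {
  pts : choiceType;
  seg : finType;
  seg_len : seg -> \bar R;
  chart : seg -> \bar R -> pts }.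

Definition space (R : realType) (C : curve R) : Type := pts C.
Coercion space : curve >-> Sortclass.

HB.instance Definition _ (R : realType) (C : curve R) :=
  Choice.copy (space C) (pts C).

Section Topology.
Variables (R : realType) (C : curve R).

(** The gluing topology: U is open iff its preimage in each segment is open in
    [0, seg_len s].  For metric graphs this is the topology of the path metric. *)
Definition curve_open : set_system (space C) := [set U | forall s : seg C,
  exists2 W : set (\bar R), open W &
    forall t : \bar R, (0 <= t <= seg_len s)%E -> U (chart s t) <-> W t].

Lemma curve_openT : curve_open setT.
Proof. by move=> s; exists setT => //; exact: openT. Qed.

Lemma curve_openI : setI_closed curve_open.
Proof.
move=> U U' oU oU' s; have [W oW UW] := oU s; have [W' oW' UW'] := oU' s.
exists (W `&` W'); first exact: openI.
by move=> t /[dup] /UW + /UW'; rewrite /setI /=; tauto.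
Qed.

Lemma curve_open_bigU (I : Type) (f : I -> set (space C)) :
  (forall i, curve_open (f i)) -> curve_open (\bigcup_i f i).
Proof.
move=> of_ s.
have /choice[W WP] i : exists W : set (\bar R), open W /\
    forall t : \bar R, (0 <= t <= seg_len s)%E -> f i (chart s t) <-> W t.
  by have [W oW fW] := of_ i s; exists W.
exists (\bigcup_i W i); first by apply: bigcup_open => i _; exact: (WP i).1.
by move=> t /[dup] ht _; split=> -[i _ ?]; exists i => //; exact/((WP i).2 t ht).
Qed.

HB.instance Definition _ := isOpenTopological.Build (space C)
  curve_openT curve_openI curve_open_bigU.

Definition at_infinity (p : C) : Prop :=
  exists s : seg C, seg_len s = +oo%E /\ chart s +oo%E = p.

(** (s, b, t) is the direction at the point chart s t%:E along which the
    parameter of s increases (if b) or decreases (if ~~ b). *)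
Definition tangent : Type := (seg C * bool * R)%type.

Definition is_tangent (z : tangent) : Prop :=
  let: (s, b, t) := z in
  if b then (0 <= t%:E < seg_len s)%E else (0 < t%:E <= seg_len s)%E.

Definition along (z : tangent) (h : R) : C :=
  let: (s, b, t) := z in chart s (if b then t + h else t - h)%:E.

Definition tangents_at (p : C) : set tangent :=
  [set z | is_tangent z /\ along z 0 = p].

(** Continuity is automatic, the affine pieces being closed intervals. On an
    unbounded segment only [0, +oo[ matters, and there are finitely many pieces. *)
Definition is_PL (f : C -> R) : Prop := forall s : seg C,
  exists B : seq R, forall a b : R,
    0 <= a -> a <= b -> (b%:E <= seg_len s)%E ->
    (forall c, c \in B -> ~~ (a < c < b)) ->
  exists m : int, forall t, a <= t <= b ->
    f (chart s t%:E) = f (chart s a%:E) + m%:~R * (t - a).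

Definition has_slope (f : C -> R) (z : tangent) (m : int) : Prop :=
  exists2 eps : R, 0 < eps & forall h, 0 <= h < eps ->
    f (along z h) = f (along z 0) + m%:~R * h.

Definition slope (f : C -> R) (z : tangent) : int := xget 0 (has_slope f z).

Definition slope_sum (f : C -> R) (p : C) : int :=
  \sum_(z \in tangents_at p) slope f z.

Definition divisor : Type := C -> int.

Definition is_divisor (D : divisor) : Prop := finite_set [set p | D p != 0].

Definition effective (D : divisor) : Prop := forall p, 0 <= D p.

Definition deg (D : divisor) : int := \sum_(p \in [set: C]) D p.

Definition div (f : C -> R) : divisor := fun p => - slope_sum f p.

Definition sections (D : divisor) : set (C -> R) :=
  [set f | is_PL f /\ effective (div f \+ D)].

Definition linsys (D : divisor) (S : set (C -> R)) : set divisor :=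
  [set div f \+ D | f in S].

Definition trop_comb (k : nat) (f : 'I_k.+1 -> C -> R) (a : 'I_k.+1 -> R) :
    C -> R :=
  fun p => \big[Num.min/f ord0 p + a ord0]_(i < k.+1) (f i p + a i).

Definition trop_span (S : set (C -> R)) : set (C -> R) :=
  [set g | exists k (f : 'I_k.+1 -> C -> R) (a : 'I_k.+1 -> R),
     (forall i, S (f i)) /\ g = trop_comb f a].

Definition trop_submodule (S : set (C -> R)) : Prop :=
  S `<=` is_PL /\ trop_span S `<=` S.

Definition trop_dependence (S : set (C -> R)) (a : (C -> R) -> R) : Prop :=
  forall p, exists f g, [/\ S f, S g, f <> g, f p + a f = g p + a g &
    forall h, S h -> f p + a f <= h p + a h].

Definition trop_dependent (S : set (C -> R)) : Prop :=
  exists a, trop_dependence S a.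

(** m is the i-th smallest (from i = 0) of the slopes along z of elements of S *)
Definition nth_slope (S : set (C -> R)) (z : tangent) (i : nat) (m : int) :=
  let slopes := [set slope f z | f in S] in
  slopes m /\ [set m' | slopes m' /\ m' < m] #= `I_i.

Inductive tropical_linear_series (D : divisor) :
    nat -> set (C -> R) -> Prop :=
| TropicalLinearSeries (r : nat) (S : set (C -> R)) of
    trop_submodule S &
    S `<=` sections D &
    (forall E : divisor, is_divisor E -> effective E -> deg E = r%:Z ->
      exists2 f, S f & forall p, E p <= (div f \+ D) p) &
    (forall T, T `<=` S -> T #= `I_r.+2 -> trop_dependent T) &
    (forall z i, is_tangent z -> (i < r)%N ->
      exists m, nth_slope S z i m /\
      exists2 S', S' `<=` [set f | S f /\ slope f z <= m] &
        tropical_linear_series D i S') :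
    tropical_linear_series D r S.

(** Sym^d C is the quotient of C^d by permutations; its points are the effective
    divisors of degree d, the quotient map being tuple_div. *)
Definition tuple_div (d : nat) (x : 'rV[C]_d) : divisor :=
  fun p => #|[set i : 'I_d | x ord0 i == p]|%:Z.

Definition sym_closed (d : nat) (Z : set divisor) : Prop :=
  closed [set x : 'rV[C]_d | Z (tuple_div x)].

(** closed for the topology induced on |D| by Sym^(deg D); when deg D < 0,
    |D| is empty *)
Definition closed_in_linsys (D : divisor) (A : set divisor) : Prop :=
  exists2 Z, sym_closed `|deg D|%N Z & A = linsys D (sections D) `&` Z.

End Topology.

Section ValuatedMatroid.
Variables (R : realType) (T : Type).

Definition supp (V : T -> \bar R) : set T := [set e | V e != +oo%E].

Definition independent (VV : set (T -> \bar R)) (A : set T) : Prop :=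
  forall V, VV V -> ~ (supp V `<=` A).

(** A function on E with values in R + {oo} is encoded as a function on T with
    the value +oo outside of E. *)
Record valuated_matroid (E : set T) (rho : nat) (VV : set (T -> \bar R)) :
    Prop := ValuatedMatroid {
  vm_range : forall V, VV V -> forall e, V e != -oo%E;
  vm_ground : forall V, VV V -> supp V `<=` E;
  vm_proper : ~ VV (cst +oo%E);
  vm_shift : forall V (a : R), VV V -> VV (fun e => V e + a%:E)%E;
  vm_incomparable : forall V1 V2, VV V1 -> VV V2 ->
    supp V1 <> supp V2 -> ~ (supp V1 `<=` supp V2);
  vm_rank_attained : exists A, [/\ A `<=` E, independent VV A & A #= `I_rho];
  vm_rank_max : forall A, A `<=` E -> independent VV A -> A #<= `I_rho;
  vm_elimination : forall V1 V2 e e', VV V1 -> VV V2 ->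
    V1 e = V2 e -> V1 e <> +oo%E -> (V1 e' < V2 e')%E ->
    exists V, [/\ VV V, V e = +oo%E, V e' = V1 e' &
      forall x, (Order.min (V1 x) (V2 x) <= V x)%E] }.

End ValuatedMatroid.

(** each circuit V of VV gives the tropical dependence min (f + V f), f in supp V *)
Definition gives_dependences (R : realType) (C : curve R)
    (VV : set ((C -> R) -> \bar R)) : Prop :=
  forall V, VV V -> trop_dependence (supp V) (fun f => fine (V f)).

(** A metric graph is given by a finite vertex set containing the points of
    valence different from 2 and by its oriented edges (loops and multiple edges
    are allowed) with their lengths. *)
Record metric_graph (R : realType) := MetricGraph {
  vertex : finType;
  edge : finType;
  src : edge -> vertex;
  tgt : edge -> vertex;
  len : edge -> R;
  len_gt0 : forall e, 0 < len e;
  vertex_gt0 : (0 < #|vertex|)%N;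
  graph_connected : forall u v : vertex,
    connect (fun x y => [exists e, ((src e == x) && (tgt e == y)) ||
                                   ((src e == y) && (tgt e == x))]) u v }.

Section MetricGraph.
Variables (R : realType) (G : metric_graph R).

Local Notation inner e := {t : \bar R | (0 < t < (len e)%:E)%E}.

Definition graph_point : choiceType := (vertex G + {e : edge G & inner e})%type.

Definition graph_chart (e : edge G) (t : \bar R) : graph_point :=
  match insub t : option (inner e) with
  | Some u => inr (Tagged (fun e => inner e) u)
  | None => inl (if (t <= 0)%E then src e else tgt e)
  end.

Definition curve_of : curve R := Curve (fun e => (len e)%:E) graph_chart.

End MetricGraph.

Coercion curve_of : metric_graph >-> curve.

Section Definable.
Variable R : realType.

Definition polyhedron (I : finType) (k : nat) (v : 'I_k -> I -> int)
    (a : 'I_k -> R) : set (I -> R) :=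
  [set u | forall j, a j <= \sum_(i : I) u i * (v j i)%:~R].

Inductive boolean_combination (I : finType) : set (I -> R) -> Prop :=
| BC_polyhedron k (v : 'I_k -> I -> int) (a : 'I_k -> R) :
    boolean_combination (polyhedron v a)
| BC_setC A of boolean_combination A : boolean_combination (~` A)
| BC_setI A B of boolean_combination A & boolean_combination B :
    boolean_combination (A `&` B)
| BC_setU A B of boolean_combination A & boolean_combination B :
    boolean_combination (A `|` B).

Variable G : metric_graph R.

(** The coordinates of a cell: de e lists the multiplicities d_e^1, ..., d_e^{r_e}. *)
Definition coord_index (de : edge G -> seq int) : finType :=
  {e : edge G & 'I_(size (de e))}.

Definition coord_div (dv : vertex G -> int) (de : edge G -> seq int)
    (u : coord_index de -> R) : divisor G :=
  fun p : graph_point G => match p with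
  | inl v => dv v
  | inr (existT e t) => \sum_(i < size (de e))
      if val t == (u (existT _ e i))%:E then (de e)`_i else 0
  end.

Definition cell (D : divisor G) (dv : vertex G -> int) (m : edge G -> int)
    (de : edge G -> seq int) : set (coord_index de -> R) :=
  [set u | [/\ forall (e : edge G) (i : 'I_(size (de e))),
                 0 < u (existT _ e i) < len e,
               forall (e : edge G) (i j : 'I_(size (de e))),
                 (i < j)%N -> u (existT _ e i) < u (existT _ e j),
               linsys D (sections D) (coord_div dv u) &
               forall f, is_PL f -> div f = coord_div dv u \- D ->
                 forall e : edge G, slope f (e, true, 0) = m e]].

(** The multiplicities d_e^i are taken positive, so that the cells are disjoint
    and the x_i are well defined. *)
Definition definable (D : divisor G) (A : set (divisor G)) : Prop :=
  forall (dv : vertex G -> int) (m : edge G -> int) (de : edge G -> seq int),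
    (forall e d, d \in de e -> 0 < d) ->
    boolean_combination [set u : coord_index de -> R | cell D dv m u /\ A (coord_div dv u)].

Record strong_tropical_linear_series (D : divisor G) (r : nat)
    (S : set (G -> R)) : Prop := StrongTropicalLinearSeries {
  strong_tls : tropical_linear_series D r S;
  strong_closed : closed_in_linsys D (linsys D S);
  strong_definable : definable D (linsys D S);
  strong_matroid : exists2 VV, valuated_matroid S r.+1 VV &
                     gives_dependences VV }.

End Definable.

Section TropicalProjectiveSpace.
Local Open Scope quotient_scope.
Variables (R : realType) (n : nat).

Definition hcoords : set 'rV[\bar R]_n.+1 :=
  [set x | (forall i, x ord0 i != -oo%E) /\ exists i, x ord0 i != +oo%E].

Definition tp_eq (x y : hcoords) : bool :=
  `[< exists c : R, forall i, (val y ord0 i = val x ord0 i + c%:E)%E >].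

Lemma tp_eq_refl : reflexive tp_eq.
Proof. by move=> x; apply/asboolP; exists 0 => i; rewrite adde0. Qed.

Lemma tp_eq_sym : symmetric tp_eq.
Proof.
suff sym x y : tp_eq x y -> tp_eq y x by move=> x y; apply/idP/idP; exact: sym.
move=> /asboolP[c xy]; apply/asboolP; exists (- c) => i.
by rewrite xy -addeA -EFinD subrr adde0.
Qed.

Lemma tp_eq_trans : transitive tp_eq.
Proof.
move=> y x z /asboolP[c xy] /asboolP[d yz]; apply/asboolP; exists (c + d) => i.
by rewrite yz xy -addeA EFinD.
Qed.

Canonical tp_equiv : equiv_rel hcoords :=
  EquivRel tp_eq tp_eq_refl tp_eq_sym tp_eq_trans.

(** with the quotient of the subspace topology on hcoords *)
Definition TP : topologicalType := quotient_topology {eq_quot tp_equiv}.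

Lemma hcoords_fin (x : 'I_n.+1 -> R) :
  (\row_i (x i)%:E : 'rV[\bar R]_n.+1) \in hcoords.
Proof. by apply/mem_set; split=> [i|]; [|exists ord0]; rewrite mxE. Qed.

Definition tp_class (x : hcoords) : TP := \pi_({eq_quot tp_equiv}) x.

Definition tp_fin (x : 'I_n.+1 -> R) : TP := tp_class (SigSub (hcoords_fin x)).

(** The tropical linear space of M, whose ground set {phi_0, ..., phi_n} is the
    range of phi. *)
Definition trop_linear_space (T : Type) (phi : 'I_n.+1 -> T)
    (M : set (T -> \bar R)) : set TP :=
  [set X | forall x, tp_class x = X -> forall V, M V ->
    let y i := (V (phi i) + val x ord0 i)%E in
    exists i j, [/\ i != j, y i = y j & forall k, (y i <= y k)%E]].

Definition tp_map (C : curve R) (phi : 'I_n.+1 -> C -> R) : C -> TP :=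
  fun p => tp_fin (fun i => phi i p).

(** F lifts Psi to homogeneous coordinates away from the points at infinity; the
    sum of the outgoing slope vectors of F lies in R(1, ..., 1), a condition which
    does not depend on the lift. *)
Definition balanced (C : curve R) (Psi : C -> TP) : Prop :=
  continuous Psi /\
  exists F : 'I_n.+1 -> C -> R,
    [/\ forall i, is_PL (F i),
        forall p, ~ at_infinity p -> Psi p = tp_fin (fun i => F i p) &
        forall p, ~ at_infinity p ->
          exists c : int, forall i, slope_sum (F i) p = c].

End TropicalProjectiveSpace.

Section Modification.
Variable R : realType.

(** attaching the ray [0, +oo] to C, its origin being glued to p *)
Local Notation ray_point := {t : \bar R | (0 < t)%E}.

Definition attach_point (C : curve R) : choiceType := (pts C + ray_point)%type.

Definition attach_chart (C : curve R) (p : C) (s : option (seg C)) (t : \bar R) :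
    attach_point C :=
  match s with
  | Some s => inl (chart s t)
  | None => match insub t : option ray_point with
            | Some u => inr u
            | None => inl p
            end
  end.

Definition attach (C : curve R) (p : C) : curve R :=
  Curve (fun s => if s is Some s' then seg_len s' else +oo%E)
        (attach_chart p).

Inductive tropical_modification (C : curve R) :
    forall C' : curve R, (C -> C') -> Prop :=
| TM_id : @tropical_modification C C id
| TM_attach (C' : curve R) (iota : C -> C') (p : C') :
    tropical_modification iota -> ~ at_infinity p ->
    @tropical_modification C (attach p) (fun q => inl (iota q)).

End Modification.

(* Main.v *)
Require Import Defs.
From mathcomp Require Import all_boot all_order all_algebra.
From mathcomp Require Import all_classical all_reals all_analysis.
From mathcomp Require Import ring lra zify.

(** Write x for a real point of B(M) and call i, j parallel at x if some circuit
    V has argmin (V + x) = {i, j}; this is parallelism in the initial matroid of M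
    at x. If P is a parallel class, x + t 1_P stays in B(M) for t up to some T > 0,
    and if T is finite then P is a union of strictly smaller parallel classes of
    x + T 1_P. If i and j are parallel at Phi(p), then phi_i - phi_j is constant
    near p, so the sum s of the outgoing slopes of Phi at p is constant on parallel
    classes. With an integer c >= max s, the vector c 1 - s is a nonnegative
    combination of vectors 1_P, so it is enough to add 1_P to the slope sum at p
    without unbalancing any other point. For this, attach at p a ray on which Phi
    is x + min(t, T) 1_P; the point t = T, where the slope sum is - 1_P, is
    balanced in turn by induction on the size of P. *)

Set Implicit Arguments.
Unset Strict Implicit.
Unset Printing Implicit Defensive.

Import Order.TTheory GRing.Theory Num.Theory.

Local Open Scope classical_set_scope.
Local Open Scope ring_scope.

(** * Circuits and parallel classes *)

(** Raising the coordinates in [P] can spoil a circuit in two ways: its minimum is attained in [P]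
    and at exactly one point outside, or the values on [P] climb past a unique minimum outside.
    Elimination excludes the first pattern for a parallel class; the second sets in at a definite
    time, the gap, and [T] is the least gap. At [T] some circuit shows the excluded pattern, so [P]
    is no longer a class and has to split. A class with one element cannot split, so its ray rises
    forever, and there the recursion ends. The obstacle is that repairing one point creates a defect
    at the bend of the new ray, on a curve that has changed meanwhile. What can be added to a slope
    sum is therefore formulated for a vector of coordinates, over all curves and all points with
    these coordinates ([addable]). If all indices are parallel, the slope sums already agree and no
    ray is attached; along such a ray all coordinates would become infinite together. *)

Section Circuits.
Variables (R : realType) (E : finType).
Implicit Types (WW : set (E -> \bar R)) (W : E -> \bar R) (P : {set E}).

(** The bound of [U] below by the minimum of [V] and [W] is written as a disjunction, ready for case
    analysis. The axioms will be used for tilted circuits and for circuits pulled back along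
    [phi]. *)
Record circuits WW : Prop := Circuits {
  circuits_ninfty : forall W, WW W -> forall e, W e != -oo%E;
  circuits_proper : ~ WW (cst +oo%E);
  circuits_shift : forall W (a : R), WW W -> WW (fun e => W e + a%:E)%E;
  circuits_incomparable : forall V W, WW V -> WW W ->
    supp V <> supp W -> ~ (supp V `<=` supp W);
  circuits_elimination : forall V W e e', WW V -> WW W ->
    V e = W e -> V e <> +oo%E -> (V e' < W e')%E ->
    exists U, [/\ WW U, U e = +oo%E, U e' = V e' &
      forall x, ((V x <= U x) || (W x <= U x))%E] }.

Definition min_twice W : Prop :=
  exists i j, [/\ i != j, W i = W j & forall k, (W i <= W k)%E].

Definition parallel WW (i j : E) : bool := (i == j) ||
  `[< exists W, [/\ WW W, W i = W j &
        forall k, k != i -> k != j -> (W i < W k)%E] >].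

Definition par_class WW (i : E) : {set E} := [set j | parallel WW i j].

(** Adding [x] to every circuit moves the point [x] to the origin, so the arguments about the
    initial matroid at [x] need no base point. *)
Definition tilt (x : E -> R) WW : set (E -> \bar R) :=
  [set (fun e => W e + (x e)%:E)%E | W in WW].

Lemma circuits_fin_min WW W i : circuits WW -> WW W ->
  (forall k, (W i <= W k)%E) -> exists a : R, W i = a%:E.
Proof.
move=> cW WWW Wi.
have := circuits_ninfty cW WWW i.
case Ei : (W i) => [a| |] // _; first by exists a.
exfalso; apply: (circuits_proper cW).
suff -> : cst +oo%E = W by [].
apply/funext => k /=; have := Wi k; rewrite Ei leye_eq => /eqP //.
Qed.

Lemma tilt_circuits WW x : circuits WW -> circuits (tilt x WW).
Proof.
move=> cW.
have supptilt W : supp (fun e => W e + (x e)%:E)%E = supp W.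
  by apply/seteqP; split=> e; rewrite /supp /=; case: (W e).
split.
- move=> _ [W WWW <-] e; have := circuits_ninfty cW WWW e.
  by case: (W e).
- move=> [W WWW WE]; apply: (circuits_proper cW).
  suff <- : W = cst +oo%E by [].
  by apply/funext => e; have := congr1 (@^~ e) WE; rewrite /=; case: (W e).
- move=> _ a [W WWW <-]; exists (fun e => W e + a%:E)%E.
    exact: circuits_shift.
  by apply/funext => e; rewrite addeAC.
- move=> _ _ [V WV <-] [W WWW <-]; rewrite !supptilt.
  exact: (@circuits_incomparable _ cW V W WV WWW).
- 
- move=> _ _ e e' [V WV <-] [W WWW <-] VWe Ve VWe'.
  have [|||U [WU Ue Ue' UVW]] := @circuits_elimination _ cW V W e e' WV WWW.
  + by move: VWe; case: (V e) => [a| |]; case: (W e) => [b| |] //= [/addIr ->].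
  + by move: Ve; case: (V e).
  + by move: VWe'; rewrite lteD2rE.
  exists (fun e => U e + (x e)%:E)%E; split.
  + by exists U.
  + by rewrite Ue.
  + by rewrite Ue'.
  + by move=> k; rewrite !leeD2rE.
Qed.

Lemma parallel_sym WW i j : parallel WW i j = parallel WW j i.
Proof.
suff sym k l : parallel WW k l -> parallel WW l k by apply/idP/idP; exact: sym.
rewrite /parallel eq_sym => /orP[->//|/asboolP[W [WWW Wkl Wm]]].
apply/orP; right; apply/asboolP; exists W; split => // m ml mk.
by rewrite -Wkl; exact: Wm.
Qed.

Lemma circuits_elimination_at WW V W e e' (a : R) : circuits WW ->
  WW V -> WW W -> V e = a%:E -> W e = a%:E -> (V e' < W e')%E ->
    exists U, [/\ WW U, U e = +oo%E, U e' = V e' &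
      forall x, ((V x <= U x) || (W x <= U x))%E].
Proof.
by move=> cW WV WWW Ve We; apply: circuits_elimination => //; rewrite Ve.
Qed.

Lemma circuits_normalize WW W i (a : R) : circuits WW -> WW W ->
  W i != +oo%E -> exists b : R,
    WW (fun e => W e + b%:E)%E /\ (W i + b%:E)%E = a%:E.
Proof.
move=> cW WWW; have := circuits_ninfty cW WWW i.
case Wi : (W i) => [c| |] // _ _; exists (a - c); split.
  exact: circuits_shift.
by rewrite -EFinD addrC subrK.
Qed.

(** The index [k] makes [W i] finite, because [W i < W k]; a shift then brings the common minimum to
    the prescribed value [a]. *)
Lemma parallel_witness WW i j k (a : R) : circuits WW ->
  parallel WW i j -> i != j -> k != i -> k != j ->
  exists W, [/\ WW W, W i = a%:E, W j = a%:E &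
    forall l, l != i -> l != j -> (a%:E < W l)%E].
Proof.
move=> cW /orP[->//|/asboolP[W [WWW Wij Wl]]] ij ki kj.
have [|b [Wb Wib]] := @circuits_normalize WW W i a cW WWW.
  by rewrite -ltey; exact: lt_le_trans (Wl _ ki kj) (leey _).
exists (fun e => W e + b%:E)%E; split => //; first by rewrite -Wij.
by move=> l li lj; rewrite -Wib lteD2rE //; exact: Wl.
Qed.

(** Eliminating [j] between circuits minimal exactly on [{i, j}] and on [{j, k}], both with minimum
    0, gives [U] with [U i = 0] and positive values off [{i, k}]. As [U] attains its minimum twice,
    [U k = 0]. *)
Lemma parallel_trans WW : circuits WW -> (forall W, WW W -> min_twice W) ->
  transitive (parallel WW).
Proof.
move=> cW W2 j i k pij pjk.
have [->//|ij] := eqVneq i j.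
have [<-//|jk] := eqVneq j k.
have [<-|ik] := eqVneq i k; first by rewrite /parallel eqxx.
have [||V [WV Vi Vj Vl]] := @parallel_witness WW i j k 0 cW pij ij.
- by rewrite eq_sym.
- by rewrite eq_sym.
have [|W [WWW Wj Wk Wl]] := @parallel_witness WW j k i 0 cW pjk jk ij.
- exact: ik.
have [|U [WU Uj Ui Ul]] := @circuits_elimination_at WW V W j i 0 cW WV WWW Vj Wj.
  by rewrite Vi; exact: Wl.
have U0 l : l != i -> l != k -> (0 < U l)%E.
  move=> li lk; have [->|lj] := eqVneq l j; first by rewrite Uj.
  by have /orP[] := Ul l; apply: lt_le_trans; [exact: Vl|exact: Wl].
apply/orP; right; apply/asboolP; exists U.
have Uk : (0 <= U k)%E.
  have /orP[] := Ul k; last by rewrite Wk.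
  by apply: le_trans; apply: ltW; apply: Vl; rewrite eq_sym.
suff Uk0 : U k = 0%E by rewrite Ui Uk0 Vi; split=> // l li lk; exact: U0.
have [a [b [ab Uab Ua]]] := W2 _ WU.
have Ua0 : (U a <= 0)%E by have := Ua i; rewrite Ui Vi.
have sub c : U c = U a -> c = i \/ c = k.
  move=> Uca; have [->|ci] := eqVneq c i; first by left.
  have [->|ck] := eqVneq c k; first by right.
  by have := U0 c ci ck; rewrite Uca ltNge Ua0.
apply/eqP; rewrite eq_le Uk andbT.
have [//|ai|<-//] := sub a; have [//|bi|bk] := sub b.
  by rewrite ai bi eqxx in ab.
by rewrite -bk -Uab.
Qed.

(* If W had its minimum at k outside of a class P and at points of P only besides,
   eliminating these points one by one against the circuits that make them
   parallel would put k in P. *)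
Lemma par_class_cross WW i W k : circuits WW ->
  (forall W, WW W -> min_twice W) -> WW W ->
  k \notin par_class WW i -> (forall l, (W k <= W l)%E) ->
  (forall l, l \notin par_class WW i -> l != k -> (W k < W l)%E) ->
  forall j, j \in par_class WW i -> W j <> W k.
Proof.
move=> cW W2 WWW kP Wk Wkl.
have Ptrans j j' : j \in par_class WW i -> j' \in par_class WW i ->
    parallel WW j j'.
  rewrite !inE => ij; rewrite parallel_sym in ij.
  exact: parallel_trans ij.
have inS U (d : E) : (d \in [set j in par_class WW i | U j == U k]) =
    (d \in par_class WW i) && (U d == U k) by rewrite finset.in_set.
have [m] := ubnP #|[set j in par_class WW i | W j == W k]|.
elim: m W WWW Wk Wkl => // m IH W WWW Wk Wkl; rewrite ltnS => Wm j jP Wj.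
have jk : j != k by apply: contraNneq kP => <-.
have [a Wka] := circuits_fin_min cW WWW Wk.
have [/existsP[j' /and3P[j'P j'j /eqP Wj']]|/existsPn noj'] :=
    boolP [exists j', [&& j' \in par_class WW i, j' != j & W j' == W k]].
  have j'k : j' != k by apply: contraNneq kP => <-.
  have [||V [WV Vj' Vj Vl]] :=
    @parallel_witness WW j' j k a cW (Ptrans _ _ j'P jP) j'j; rewrite 1?eq_sym//.
  have [||U [WU Uj' Uk Ul]] :=
    @circuits_elimination_at WW W V j' k a cW WWW WV _ Vj'.
  - by rewrite Wj'.
  - by rewrite Wka; apply: Vl; rewrite eq_sym.
  have UkE l : (U k <= U l)%E.
    rewrite Uk; have /orP[] := Ul l; apply: le_trans => //.
    rewrite Wka; have [->|lj'] := eqVneq l j'; first by rewrite Vj'.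
    have [->|lj] := eqVneq l j; first by rewrite Vj.
    by apply: ltW; exact: Vl.
  have UkP l : l \notin par_class WW i -> l != k -> (U k < U l)%E.
    move=> lP lk; rewrite Uk; have /orP[] := Ul l; apply: lt_le_trans.
      exact: Wkl.
    by rewrite Wka; apply: Vl; apply: contraNneq lP => ->.
  (* Outside of the class [U] attains its minimum at [k] only, so it also does at some [l] in the
     class; since [U] has lost [j'], the induction hypothesis refutes [l]. *)
  have [b [c [bc Ubc Ub]]] := W2 _ WU.
  have UbE : U b = U k by apply/eqP; rewrite eq_le UkE Ub.
  have [l lP Ulk] : exists2 l, l \in par_class WW i & U l = U k.
    have dic d : U d = U k -> d \in par_class WW i \/ d = k.
      move=> Ud; have [dP|dP] := boolP (d \in par_class WW i); first by left.
      have [->|dk] := eqVneq d k; first by right.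
      by have := UkP d dP dk; rewrite Ud ltxx.
    have [//|bP|bk] := dic b; first by exists b.
    have [|cP|ck] := dic c; first by rewrite -Ubc.
      by exists c; rewrite // -Ubc.
    by rewrite bk ck eqxx in bc.
  apply: (IH U WU UkE UkP _ l lP Ulk).
  apply: leq_trans Wm; apply: proper_card; apply/properP; split.
    apply/fintype.subsetP => d; rewrite !inS => /andP[-> /= /eqP Ud].
    rewrite eq_le Wk andbT; have /orP[] := Ul d; first by rewrite Ud Uk.
    have [->|dj'] := eqVneq d j'; first by rewrite Wj'.
    have [->|dj] := eqVneq d j; first by rewrite Wj.
    by rewrite Ud Uk leNgt Wka Vl.
  by exists j'; rewrite inS j'P ?Wj' ?eqxx//= Uj' Uk Wka.
(* Now [j] is the only point of the class at the minimum, so [W] itself witnesses that [j] and [k]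
   are parallel. *)
have kPin : k \in par_class WW i; last by rewrite kPin in kP.
rewrite finset.in_set; move: (jP); rewrite finset.in_set => ij.
apply: parallel_trans ij _ => //; apply/orP; right; apply/asboolP.
exists W; split=> // l lj lk; rewrite Wj.
have [lP|/Wkl] := boolP (l \in par_class WW i); last exact.
rewrite lt_neqAle Wk andbT eq_sym.
by have := noj' l; rewrite lP lj.
Qed.

(** Shift [V] so that both agree at a point [e] of the support. If they still differed somewhere,
    eliminating [e] would give a circuit of strictly smaller support. *)
Lemma supp_eq_shift WW V W : circuits WW -> WW V -> WW W ->
  supp V = supp W -> exists b : R, forall e, W e = (V e + b%:E)%E.
Proof.
move=> cW WV WWW VW.
have key U U' e (a : R) e' : WW U -> WW U' -> U e = a%:E -> U' e = a%:E ->
    supp U = supp U' -> ~ (U e' < U' e')%E.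
  move=> WU WU' Ue U'e UU' lt.
  have [X [WX Xe Xe' Xl]] := circuits_elimination_at cW WU WU' Ue U'e lt.
  apply: (circuits_incomparable cW WX WU).
    move=> /seteqP[_ /(_ e)]; rewrite /supp /= Ue Xe => /(_ isT).
    by rewrite eqxx.
  move=> x Xx; have := Xl x; move: Xx; rewrite /supp/= => Xx /orP[] le.
    by rewrite -ltey; apply: le_lt_trans le _; rewrite ltey.
  suff : supp U x by [].
  by rewrite UU' /supp/= -ltey; apply: le_lt_trans le _; rewrite ltey.
have [e Ve] : exists e, V e != +oo%E.
  apply: contrapT => /forallNP nV; apply: (circuits_proper cW).
  suff <- : V = cst +oo%E by [].
  by apply/funext => e /=; apply/eqP; apply: contrapT => /negP; exact: nV.
have [a [b Wea]] : exists a b : R, W e = a%:E /\ (V e + b%:E)%E = a%:E.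
  have : supp W e by rewrite -VW.
  have := circuits_ninfty cW WWW e; rewrite /supp/=.
  case: (W e) => [a| |] // _ _; exists a.
  by have [b [_ Vb]] := circuits_normalize a cW WV Ve; exists b.
exists b => e'.
have WVb := circuits_shift cW b WV.
have sVb : supp (fun e => V e + b%:E)%E = supp W.
  by rewrite -VW; apply/seteqP; split=> x; rewrite /supp/=; case: (V x).
case: Wea => We Ve'.
apply/eqP; rewrite eq_le !leNgt; apply/andP; split; apply/negP.
  exact: (@key _ _ e a e' WVb WWW Ve' We sVb).
by apply: (@key _ _ e a e' WWW WVb We Ve'); rewrite sVb.
Qed.

(** [t] is an extended real because the end of an unbounded ray has to be checked too. Applied to
    circuits tilted by [x] this evaluates them at [x + t 1_P]; applied to coordinates it gives that
    point. *)
Definition push P (t : \bar R) W (e : E) : \bar R :=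
  (W e + (if e \in P then t else 0))%E.

(* W stops attaining its minimum twice along the ray x + t 1_P exactly at t = g. *)
Definition gap P W (g : R) : Prop := exists j k (a : R),
  [/\ j \in P /\ k \notin P, W j = a%:E /\ W k = (a + g)%:E, 0 < g,
      forall l, l \in P -> (W j <= W l)%E &
      forall l, l \notin P -> l != k -> (W k < W l)%E].

(** Let [m] be the minimum of [W]. If no outer value equals [m] or lies below [m + t], the two old
    minimisers are in [P] and survive. Otherwise a tie among the least outer values gives two
    minimisers. A unique least outer value cannot be [m], by [par_class_cross], nor lie strictly
    between [m] and [m + t], as this would be a gap smaller than [t]. *)
Lemma push_min_twice WW i W (t : \bar R) : circuits WW ->
  (forall W, WW W -> min_twice W) -> WW W -> (0 <= t)%E ->
  (forall g, gap (par_class WW i) W g -> (t <= g%:E)%E) ->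
  min_twice (push (par_class WW i) t W).
Proof.
move=> cW W2 WWW t0 Wgap; set P := par_class WW i.
have pushN l : l \notin P -> push P t W l = W l.
  by move=> /negbTE lP; rewrite /push lP adde0.
have pushP l : l \in P -> push P t W l = (W l + t)%E by rewrite /push => ->.
have [i1 [i2 [i12 W12 Wmin]]] := W2 _ WWW.
have [m Wi1] := circuits_fin_min cW WWW Wmin.
(* The alternative [W k = m%:E] covers [t = 0]; for [t > 0] it is a case of the first. *)
have [[k [kP Wk]]|/forallNP far] :=
    pselect (exists k, k \notin P /\ ((W k < m%:E + t)%E \/ W k = m%:E)); last first.
  have iP j : W j = m%:E -> j \in P.
    move=> Wj; apply: contrapT => /negP jP; apply: (far j); split=> //.
    by right.
  have i1P := iP _ Wi1; have i2P : i2 \in P by apply: iP; rewrite -W12.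
  exists i1, i2; split=> //; first by rewrite !pushP // W12.
  move=> l; rewrite pushP //; have [lP|lP] := boolP (l \in P).
    by rewrite pushP // leeD2r.
  rewrite pushN // Wi1 leNgt; apply/negP => lt; apply: (far l).
  by split=> //; left.
have [k0 k0P k0min] : exists2 k0, k0 \notin P &
    forall l, l \notin P -> (W k0 <= W l)%E.
  case: (@Order.TotalTheory.arg_minP _ _ _ k (fun l => l \notin P) W kP).
  by move=> k0 ? ?; exists k0.
have Wk0 : (W k0 <= m%:E + t)%E.
  apply: le_trans (k0min _ kP) _; case: Wk => [/ltW//|->].
  by rewrite leeDl.
have [[l [lP lk0 Wl]]|/forallNP nol] :=
    pselect (exists l, [/\ l \notin P, l != k0 & W l = W k0]).
  exists k0, l; split; rewrite 1?eq_sym//.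
    by rewrite !pushN.
  move=> c; rewrite pushN //; have [cP|cP] := boolP (c \in P).
    by rewrite pushP //; apply: le_trans Wk0 _; rewrite leeD2r // -Wi1.
  by rewrite pushN //; exact: k0min.
have k0lt l : l \notin P -> l != k0 -> (W k0 < W l)%E.
  move=> lP lk; rewrite lt_neqAle k0min // andbT; apply/eqP => Wl.
  exact: (nol l).
exfalso; have [Wk0m|Wk0m] := eqVneq (W k0) m%:E.
  have k0all l : (W k0 <= W l)%E by rewrite Wk0m -Wi1.
  have [j jk0 Wj] : exists2 j, j != k0 & W j = W k0.
    have [i1k|i1k] := eqVneq i1 k0; last by exists i1; rewrite // Wk0m.
    by exists i2; rewrite -?W12 ?Wk0m // -i1k eq_sym.
  have jP : j \in P.
    apply: contrapT => /negP jP; have := k0lt j jP jk0.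
    by rewrite Wj ltxx.
  exact: (@par_class_cross WW i W k0 cW W2 WWW k0P k0all k0lt j jP Wj).
have iP j : W j = m%:E -> j \in P.
  move=> Wj; apply: contrapT => /negP jP; move/eqP: Wk0m; apply.
  by apply/eqP; rewrite eq_le -{1}Wj k0min // -Wi1 Wmin.
have Wkt : (W k0 < m%:E + t)%E.
  apply: le_lt_trans (k0min _ kP) _; case: Wk => // /iP.
  by rewrite (negbTE kP).
have i1P := iP _ Wi1.
have [b Wk0b] : exists b : R, W k0 = b%:E.
  have := circuits_ninfty cW WWW k0; case Wk0E : (W k0) Wkt => [b| |] // Wkt _.
    by exists b.
  by move: Wkt; rewrite ltNge leey.
have mb : m < b.
  by rewrite -lte_fin -Wk0b lt_neqAle eq_sym Wk0m -Wi1 Wmin.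
have : (t <= (b - m)%:E)%E.
  apply: Wgap; exists i1, k0, m; split=> //.
  - by rewrite addrC subrK.
  - by rewrite subr_gt0.
apply/negP; rewrite -ltNge EFinB lteBlDl //.
by rewrite -Wk0b.
Qed.

Lemma gap_inj P W g g' : gap P W g -> gap P W g' -> g = g'.
Proof.
move=> [j [k [a [[jP kP] [Wj Wk] _ jmin kmin]]]].
move=> [j' [k' [a' [[jP' kP'] [Wj' Wk'] _ jmin' kmin']]]].
have kk' : k = k'.
  apply/eqP; apply: contrapT => /negP kk'.
  have := kmin' k kP kk'; rewrite ltNge => /negP; apply; apply: ltW.
  by apply: kmin => //; rewrite eq_sym.
have aa' : a = a'.
  have : W j = W j' by apply/eqP; rewrite eq_le jmin // jmin'.
  by rewrite Wj Wj' => -[].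
by move: Wk Wk'; rewrite kk' aa' => -> [/addrI].
Qed.

Lemma gap_shift P W g (b : R) : gap P W g -> gap P (fun e => W e + b%:E)%E g.
Proof.
move=> [j [k [a [[jP kP] [Wj Wk] g0 jmin kmin]]]].
exists j, k, (a + b); split=> //.
- by rewrite Wj Wk -!EFinD addrAC.
- by move=> l lP; rewrite leeD2rE // jmin.
- by move=> l lP lk; rewrite lteD2rE // kmin.
Qed.

(* The gap is attained because, up to shifts, a circuit is determined by its
   support. *)
Lemma min_gap WW P : circuits WW ->
  (exists W g, WW W /\ gap P W g) -> exists W g, [/\ WW W, gap P W g &
    forall W' g', WW W' -> gap P W' g' -> g <= g'].
Proof.
move=> cW [W0 [g0 [WW0 gap0]]].
pose G (A : {set E}) := [set g | exists W, [/\ WW W, gap P W g &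
  A = [set e | W e != +oo%E]%SET]].
pose Q A := `[< exists g, G A g >].
have Q0 : Q [set e | W0 e != +oo%E]%SET by apply/asboolP; exists g0, W0.
case: (@Order.TotalTheory.arg_minP _ _ _ _ Q (fun A => xget 0 (G A)) Q0).
move=> A QA Amin.
have GA B : Q B -> G B (xget 0 (G B)) by move=> /asboolP[g]; exact: xgetI.
have [W [WWW Wgap AE]] := GA _ QA.
exists W, (xget 0 (G A)); split=> // W' g' WW' gap'.
pose B := [set e | W' e != +oo%E]%SET.
have QB : Q B by apply/asboolP; exists g', W'.
have [V [WV Vgap BE]] := GA _ QB.
have sVW : supp V = supp W'.
  have inB U (e : E) : (e \in [set e | U e != +oo%E]%SET) = (U e != +oo%E).
    by rewrite finset.in_set.
  by apply/seteqP; split=> e; rewrite /supp /= -!inB -/B BE.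
have [b WVb] := supp_eq_shift cW WV WW' sVW.
have W'E : W' = (fun e => V e + b%:E)%E by apply/funext.
have -> : g' = xget 0 (G B).
  by apply: gap_inj gap' _; rewrite W'E; exact: gap_shift.
exact: Amin.
Qed.

(** [T] is the least gap of a circuit, or [+oo] if no circuit has one. *)
Lemma ray_length WW i : circuits WW -> (forall W, WW W -> min_twice W) ->
  let P := par_class WW i in
  exists T : \bar R, [/\ (0 < T)%E,
    forall t W, (0 <= t <= T)%E -> WW W -> min_twice (push P t W) &
    forall (s : R) j, T = s%:E -> j \in P ->
      par_class (tilt (fun e => if e \in P then s else 0) WW) j \proper P].
Proof.
move=> cW W2 P.
have [hgap|/forallNP nogap] := pselect (exists W g, WW W /\ gap P W g); last first.
  exists +oo%E; split=> // t W /andP[t0 _] WWW.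
  apply: push_min_twice => // g Wg; exfalso; apply: (nogap W).
  by exists g.
have [W [g [WWW Wgap gmin]]] := min_gap cW hgap.
have [j [k [a [[jP kP] [Wj Wk] g0 jmin kmin]]]] := Wgap.
have tw t V : (0 <= t <= g%:E)%E -> WW V -> min_twice (push P t V).
  move=> /andP[t0 tg] WV; apply: push_min_twice => // g' Vg'.
  by apply: le_trans tg _; rewrite lee_fin; exact: gmin Vg'.
exists g%:E; split=> // s i1 [<-] i1P.
set WW' := tilt _ _.
have WW'E V : WW V -> WW' (push P g%:E V).
  move=> WV; exists V => //; apply/funext => e; rewrite /push.
  by case: ifP.
have cW' : circuits WW' by exact: tilt_circuits.
have W2' V : WW' V -> min_twice V.
  move=> [U WU <-]; have := tw g%:E U; rewrite lexx lee_fin (ltW g0) => /(_ isT WU).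
  congr min_twice; apply/funext => e; rewrite /push.
  by case: ifP.
rewrite finset.properEneq; apply/andP; split; last first.
  (* A circuit that ties [i1] to some [l] outside of [P] after the push by [g > 0] would have had
     its minimum at [i1] alone before. *)
  apply/fintype.subsetP => l; rewrite inE => /orP[/eqP<-//|].
  move=> /asboolP[_ [[V WV <-]]]; rewrite i1P => Vl Vmin.
  apply: contrapT => /negP lP; rewrite (negbTE lP) adde0 in Vl.
  have Vfin : exists b : R, V i1 = b%:E.
    have := circuits_ninfty cW WV i1; case Vi1 : (V i1) => [b| |] // _.
      by exists b.
    exfalso; apply: (circuits_proper cW); suff <- : V = cst +oo%E by [].
    apply/funext => e /=; have [->//|ei1] := eqVneq e i1.
    have [->|el] := eqVneq e l; first by rewrite -Vl Vi1.
    by have := Vmin e ei1 el; rewrite Vi1 /= ltNge leey.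
  have [b Vi1] := Vfin.
  have Vlt e : e != i1 -> (V i1 < V e)%E.
    move=> ei1; have [->|el] := eqVneq e l.
      by rewrite -Vl Vi1 -EFinD lte_fin ltrDl.
    have := Vmin e ei1 el; case: ifP => eP; first by rewrite lteD2rE.
    by rewrite adde0; apply: lt_trans; rewrite Vi1 -EFinD lte_fin ltrDl.
  have [c [d [cd Vcd Vc]]] := W2 _ WV.
  have ci1 : c = i1.
    by apply/eqP; apply: contrapT => /negP /Vlt; rewrite ltNge Vc.
  have di1 : d = i1.
    by apply/eqP; apply: contrapT => /negP /Vlt; rewrite ltNge -Vcd Vc.
  by rewrite ci1 di1 eqxx in cd.
(* If [P] were still a class, the circuit [W] of least gap, now minimal at [j] in [P] and at the
   single outer point [k], would contradict [par_class_cross]. *)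
apply/eqP => PE.
apply: (@par_class_cross WW' i1 (push P g%:E W) k cW' W2' (WW'E _ WWW) _ _ _ j).
- by rewrite PE.
- move=> l; rewrite /push (negbTE kP) adde0; case: ifP => lP.
    by rewrite Wk EFinD -Wj leeD2rE // jmin.
  rewrite adde0; have [->//|lk] := eqVneq l k; apply: ltW; apply: kmin => //.
  by rewrite lP.
- move=> l; rewrite PE /push (negbTE kP) => lP lk; rewrite (negbTE lP) !adde0.
  exact: kmin.
- by rewrite PE.
- by rewrite /push jP (negbTE kP) Wj Wk adde0.
Qed.

End Circuits.

(** * Slopes and attached rays *)

Section Slopes.
Variables (R : realType) (C : curve R).
Implicit Types (f : C -> R) (z : tangent C).

Lemma has_slope_slope f z m : has_slope f z m -> slope f z = m.
Proof.
move=> fm; rewrite /slope; case: xgetP => [m' _ fm'|/(_ m)//].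
move: fm fm' => [e e0 fm] [e' e'0 fm'].
pose d := Num.min e e' / 2.
have m0 : 0 < Num.min e e' by rewrite lt_min e0.
have d0 : 0 < d by rewrite divr_gt0.
have dm : d < Num.min e e' by rewrite /d; lra.
move: dm; rewrite lt_min => /andP[de de'].
have := fm d; have := fm' d; rewrite (ltW d0) de de' => /(_ isT) -> /(_ isT).
move=> /addrI /(mulIf (lt0r_neq0 d0)) /eqP; rewrite eqr_int => /eqP //.
Qed.

Lemma break_free (B : seq R) (t : R) :
  exists2 e : R, 0 < e & forall c, c \in B -> c != t -> e <= `|c - t|.
Proof.
elim: B => [|c B [e e0 eB]]; first by exists 1.
have [ct|ct] := eqVneq c t.
  by exists e => // d; rewrite inE => /orP[/eqP->|/eB//]; rewrite ct eqxx.
have ct0 : 0 < `|c - t| by rewrite normr_gt0 subr_eq0.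
exists (Num.min e `|c - t|); first by rewrite lt_min e0.
move=> d; rewrite inE ge_min => /orP[/eqP->|/eB dB /dB ->] //.
by rewrite lexx orbT.
Qed.

Lemma PL_right_slope f (s : seg C) (t : R) : is_PL f ->
  (0 <= t%:E < seg_len s)%E -> exists m, has_slope f (s, true, t) m.
Proof.
move=> /(_ s)[B PB] /andP[t0 tl].
have [e e0 eB] := break_free B t.
have [d d0 [de dl]] : exists2 d : R, 0 < d & d <= e /\ ((t + d)%:E <= seg_len s)%E.
  case: (seg_len s) tl => [l| |] //; last first.
    by exists e; rewrite // leey.
  rewrite lte_fin => tl; exists (Num.min e (l - t)).
    by rewrite lt_min e0 subr_gt0.
  rewrite ge_min lexx; split=> //; rewrite lee_fin -lerBrDl ge_min lexx.
  by rewrite orbT.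
have [| | |c cB|m fm] := PB t (t + d).
- by rewrite -lee_fin.
- by rewrite lerDl ltW.
- exact: dl.
- apply/negP => /andP[tc cd]; have := eB c cB; rewrite gt_eqF // => /(_ isT).
  by rewrite leNgt gtr0_norm ?subr_gt0 // => /negP; apply; lra.
exists m, d => // h /andP[h0 hd] /=.
rewrite addr0 fm; last by apply/andP; split; lra.
by rewrite (addrC t h) addrK.
Qed.

Lemma PL_left_slope f (s : seg C) (t : R) : is_PL f ->
  (0 < t%:E <= seg_len s)%E -> exists m, has_slope f (s, false, t) m.
Proof.
move=> /(_ s)[B PB] /andP[]; rewrite lte_fin => t0 tl.
have [e e0 eB] := break_free B t.
pose d := Num.min e t.
have d0 : 0 < d by rewrite lt_min e0.
have de : d <= e by rewrite ge_min lexx.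
have dt : d <= t by rewrite ge_min lexx orbT.
have [| | |c cB|m fm] := PB (t - d) t.
- by rewrite subr_ge0.
- by rewrite gerBl ltW.
- exact: tl.
- apply/negP => /andP[tc cd]; have := eB c cB; rewrite lt_eqF // => /(_ isT).
  by rewrite leNgt ltr0_norm ?subr_lt0 // => /negP; apply; lra.
exists (- m), d => // h /andP[h0 hd] /=.
have := fm (t - h); have := fm t.
rewrite subr0 => ->; last by apply/andP; split; lra.
move=> ->; last by apply/andP; split; lra.
by rewrite mulrNz; ring.
Qed.

Lemma PL_has_slope f z : is_PL f -> is_tangent z -> has_slope f z (slope f z).
Proof.
case: z => [[s b] t] fPL; case: b => zt.
  by have [m fm] := PL_right_slope fPL zt; rewrite (has_slope_slope fm).
by have [m fm] := PL_left_slope fPL zt; rewrite (has_slope_slope fm).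
Qed.

(** Off the break points both directions lie on one affine piece; this confines the defects inside
    an edge to finitely many points. *)
Lemma PL_interior_slopes f (s : seg C) : is_PL f -> exists B : seq R,
  forall t : R, 0 < t -> (t%:E < seg_len s)%E -> t \notin B ->
  slope f (s, false, t) = - slope f (s, true, t).
Proof.
move=> /(_ s)[B PB]; exists B => t t0 tl tB.
have [e e0 eB] := break_free B t.
have [d d0 [de dt dl]] : exists2 d : R, 0 < d &
    [/\ d <= e, d <= t & ((t + d)%:E <= seg_len s)%E].
  case: (seg_len s) tl => [l| |] //; last first.
    exists (Num.min e t); first by rewrite lt_min e0.
    by rewrite !ge_min !lexx orbT leey.
  rewrite lte_fin => tl; exists (Num.min (Num.min e t) (l - t)).
    by rewrite !lt_min e0 subr_gt0 t0.
  by rewrite lee_fin -lerBrDl !ge_min !lexx !orbT.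
have [| | |c cB|m fm] := PB (t - d) (t + d).
- by rewrite subr_ge0.
- by lra.
- exact: dl.
- apply/negP => cd; have ct : c != t by apply: contraNneq tB => <-.
  have := eB c cB ct; rewrite leNgt => /negP; apply.
  by apply: lt_le_trans de; rewrite ltr_distl.
rewrite (@has_slope_slope _ (s, true, t) m); last first.
  exists d => // h /andP[h0 hd] /=; have := fm (t + h); have := fm t.
  rewrite addr0 => ->; last by apply/andP; split; lra.
  move=> ->; last by apply/andP; split; lra.
  by ring.
apply: has_slope_slope; exists d => // h /andP[h0 hd] /=.
have := fm (t - h); have := fm t.
rewrite subr0 => ->; last by apply/andP; split; lra.
move=> ->; last by apply/andP; split; lra.
by rewrite mulrNz; ring.
Qed.

End Slopes.

Section Attach.
Variables (R : realType) (C : curve R) (p : C).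
Implicit Types (f : attach p -> R) (q : C).

Lemma attach_chart_gt0 (t : \bar R) (t0 : (0 < t)%E) :
  @chart R (attach p) None t = inr (exist _ t t0).
Proof. by rewrite /= insubT. Qed.

Lemma attach_chart_le0 (t : \bar R) : (t <= 0)%E ->
  @chart R (attach p) None t = inl p.
Proof.
by move=> t0; rewrite /= /attach_chart; case: insubP => // u; rewrite ltNge t0.
Qed.

Lemma attach_at_infinity q :
  at_infinity (inl q : attach p) <-> at_infinity q.
Proof.
split=> [[[s|] [sl]]|[s [sl sq]]].
- by move=> [sq]; exists s.
- by rewrite attach_chart_gt0.
- by exists (Some s); split=> //=; rewrite sq.
Qed.

Lemma attach_inr_at_infinity (u : {t : \bar R | (0 < t)%E}) :
  ~ at_infinity (inr u : attach p) -> exists2 t : R, val u = t%:E & 0 < t.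
Proof.
case: u => -[t| |] // t0 noinf; first by exists t; rewrite // -lte_fin.
by exfalso; apply: noinf; exists None; split=> //; rewrite attach_chart_gt0.
Qed.

Definition lift_tangent (z : tangent C) : tangent (attach p) :=
  (Some z.1.1, z.1.2, z.2).

Lemma lift_tangent_inj : injective lift_tangent.
Proof. by move=> [[s b] t] [[s' b'] t'] [-> -> ->]. Qed.

Lemma slope_lift f z : slope f (lift_tangent z) = slope (f \o inl) z.
Proof. by case: z => [[s []] t]. Qed.

Lemma tangents_at_inl q : tangents_at (inl q : attach p) =
  (lift_tangent @` tangents_at q) `|`
  (if q == p then [set (None, true, 0)] else set0).
Proof.
apply/seteqP; split=> [[[[s|] b] t] [zt zq]|].
- by left; exists (s, b, t) => //; split=> //; case: zq.
- move: zt zq; rewrite /is_tangent /along; case: b => [|] /andP[t0 tl].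
    rewrite addr0; have [t00|t00] := ltP (0 : R) t.
      by rewrite attach_chart_gt0.
    rewrite attach_chart_le0 ?lee_fin // => -[pq]; right.
    rewrite -pq eqxx; congr (_, _, _); apply/eqP.
    by rewrite eq_le t00 -lee_fin.
  by rewrite subr0 attach_chart_gt0.
- move=> z [[[[s b] t] [zt zq] <-]|].
    by split=> //; rewrite /along /lift_tangent /= -zq.
  have [->|//] := eqVneq q p => ->; split; rewrite /is_tangent /along.
    by rewrite /= lexx ltry.
  by rewrite addr0 attach_chart_le0.
Qed.

Lemma tangents_at_inr (u : {t : \bar R | (0 < t)%E}) (t : R) :
  val u = t%:E -> tangents_at (inr u : attach p) =
  [set (None, true, t)] `|` [set (None, false, t)].
Proof.
case: u => ut ut0 /= utt; subst ut.
apply/seteqP; split=> [[[[s|] b] t'] [zt zq]|].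
- by case: zq.
- have : @chart R (attach p) None t'%:E = inr (exist _ t%:E ut0).
    by move: zq; rewrite /along; case: ifP; rewrite ?addr0 ?subr0.
  have [t'0|t'0] := ltP (0 : \bar R)%E t'%:E; last by rewrite attach_chart_le0.
  rewrite attach_chart_gt0 => -[<-].
  by case: (b); [left|right].
- move=> z [] ->; split; rewrite /is_tangent /along ?addr0 ?subr0.
  + by rewrite /= (ltW ut0) ltry.
  + by rewrite (attach_chart_gt0 ut0).
  + by rewrite ut0 leey.
  + by rewrite (attach_chart_gt0 ut0).
Qed.

Lemma tangents_at_inr_infty (u : {t : \bar R | (0 < t)%E}) :
  val u = +oo%E -> tangents_at (inr u : attach p) = set0.
Proof.
case: u => ut ut0 /= utt; subst ut.
apply/seteqP; split=> [[[[s|] b] t'] [zt zq]|//]; first by case: zq.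
exfalso; move: zq; rewrite /along.
set t'' := (if b then _ else _).
have [t0|t0] := ltP (0 : \bar R)%E t''%:E; last by rewrite attach_chart_le0.
by rewrite attach_chart_gt0 => -[].
Qed.

Lemma attach_finite_tangents (q : attach p) :
  (forall q', finite_set (tangents_at q')) -> finite_set (tangents_at q).
Proof.
move=> fin; case: q => [q|u].
  rewrite tangents_at_inl finite_setU; split; first exact: finite_image.
  by case: ifP => _; [exact: finite_set1|exact: finite_set0].
case: u => -[t| |] u0 //.
  rewrite (@tangents_at_inr _ t) // finite_setU; split; exact: finite_set1.
by rewrite tangents_at_inr_infty //; exact: finite_set0.
Qed.

Lemma slope_sum_inl f q : finite_set (tangents_at q) ->
  slope_sum f (inl q) = slope_sum (f \o inl) q +
    (if q == p then slope f (None, true, 0) else 0).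
Proof.
move=> fin; rewrite /slope_sum tangents_at_inl fsbigU0.
- congr (_ + _).
    rewrite fsbig_image; last by move=> z z' _ _ /lift_tangent_inj.
    by apply: eq_fsbigr => z _; exact: slope_lift.
  by case: ifP => _; [rewrite fsbig_set1|rewrite fsbig_set0].
- exact: finite_image.
- by case: ifP => _; [exact: finite_set1|exact: finite_set0].
- by move=> z [[z' _ <-]]; case: ifP.
Qed.

Lemma slope_sum_inr f (u : {t : \bar R | (0 < t)%E}) (t : R) : val u = t%:E ->
  slope_sum f (inr u) = slope f (None, true, t) + slope f (None, false, t).
Proof.
move=> ut; rewrite /slope_sum (tangents_at_inr ut) fsbigU0 ?fsbig_set1 //.
by move=> z [->].
Qed.

End Attach.

(** * Continuity of maps to the extended reals and to tropical projective space *)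

Section ExtendedReals.
Variable R : realType.

Lemma ereal_continuousP (X : topologicalType) (f : X -> \bar R) :
  (forall a, open [set x | (f x < a)%E]) ->
  (forall a, open [set x | (a < f x)%E]) -> continuous f.
Proof.
move=> lo hi x A; rewrite /nbhs /=; case fx : (f x) => [r| |] /=.
- move=> /nbhs_ballP[e /= e0 eA].
  have : nbhs x ([set x | (f x < (r + e)%:E)%E] `&` [set x | ((r - e)%:E < f x)%E]).
    apply: filterI; apply: open_nbhs_nbhs; split => //=; rewrite fx lte_fin.
      by rewrite ltrDl.
    by rewrite gtrBl.
  apply: filterS => y /= []; case fy : (f y) => [s| |] //.
  rewrite !lte_fin => sr rs; apply: eA.
  by rewrite /ball /= distrC ltr_distl rs.
- move=> [M [_ MA]].
  have : nbhs x [set x | (M%:E < f x)%E].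
    by apply: open_nbhs_nbhs; split => //=; rewrite fx ltry.
  by apply: filterS => y; exact: MA.
- move=> [M [_ MA]].
  have : nbhs x [set x | (f x < M%:E)%E].
    by apply: open_nbhs_nbhs; split => //=; rewrite fx ltNyr.
  by apply: filterS => y; exact: MA.
Qed.

(** Composing with this retraction onto [[0, T]] extends a map given on a segment to all of
    [\bar R]; preimages of open sets are then the sets [W] that [curve_open] asks for. *)
Definition clamp (T t : \bar R) : \bar R := Order.max 0%E (Order.min t T).

Lemma clamp_itv T t : (0 <= T)%E -> (0 <= clamp T t <= T)%E.
Proof. by move=> T0; rewrite /clamp le_max lexx /= ge_max T0 ge_min lexx orbT. Qed.

Lemma clamp_id T t : (0 <= t <= T)%E -> clamp T t = t.
Proof. by move=> /andP[t0 tT]; rewrite /clamp min_l // max_r. Qed.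

Lemma clamp_continuous T : continuous (clamp T).
Proof.
apply: ereal_continuousP => a.
- under eq_set do rewrite /clamp gt_max gt_min.
  have [a0|a0] := boolP (0 < a)%E; last first.
    by rewrite (_ : [set _ | _] = set0); [exact: open0|apply/seteqP; split].
  have [Ta|Ta] := boolP (T < a)%E.
    rewrite (_ : [set _ | _] = setT); first exact: openT.
    by apply/seteqP; split=> // t _ /=; rewrite orbT.
  rewrite (_ : [set _ | _] = [set t | (t < a)%E]); first exact: open_ereal_lt_ereal.
  by apply/seteqP; split=> t /=; rewrite orbF.
- under eq_set do rewrite /clamp lt_max lt_min.
  have [a0|a0] := boolP (a < 0)%E.
    rewrite (_ : [set _ | _] = setT); first exact: openT.
    by apply/seteqP; split.
  have [Ta|Ta] := boolP (a < T)%E; last first.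
    rewrite (_ : [set _ | _] = set0); first exact: open0.
    by apply/seteqP; split=> // t /=; rewrite andbF.
  rewrite (_ : [set _ | _] = [set t | (a < t)%E]); first exact: open_ereal_gt_ereal.
  by apply/seteqP; split=> t /=; rewrite andbT.
Qed.

End ExtendedReals.

Section TropicalPoints.
Variables (R : realType) (n : nat).

(* Junk value if x is not a vector of homogeneous coordinates. *)
Definition tp_ext (x : 'I_n.+1 -> \bar R) : TP R n :=
  tp_class (insubd (SigSub (hcoords_fin (fun=> 0 : R))) (\row_i x i)).

Lemma tp_ext_val (x : 'I_n.+1 -> \bar R) :
  (forall i, x i != -oo%E) -> (exists i, x i != +oo%E) ->
  \row_i x i \in @hcoords R n.
Proof.
move=> xN [i xi]; apply/mem_set; split=> [j|]; first by rewrite mxE.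
by exists i; rewrite mxE.
Qed.

Lemma tp_ext_fin (x : 'I_n.+1 -> R) : tp_ext (EFin \o x) = tp_fin x.
Proof.
rewrite /tp_ext /tp_fin; congr tp_class; apply: val_inj.
rewrite val_insubd /=.
case: ifPn => //; rewrite hcoords_fin //.
Qed.

Lemma tp_ext_continuous (X : topologicalType) (x : X -> 'I_n.+1 -> \bar R) :
  (forall t i, x t i != -oo%E) -> (forall t, exists i, x t i != +oo%E) ->
  (forall i, continuous (fun t => x t i)) -> continuous (fun t => tp_ext (x t)).
Proof.
move=> xN xy xc.
pose r t : @hcoords R n := SigSub (tp_ext_val (xN t) (xy t)).
have -> : (fun t => tp_ext (x t)) = (@tp_class R n) \o r.
  apply/funext => t; rewrite /tp_ext /=; congr tp_class; apply: val_inj.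
  by rewrite val_insubd tp_ext_val.
move=> t; apply: continuous_comp; last exact: pi_continuous.
apply: continuous_comp_initial => {}t A /= [P Pn PA].
have : \forall s \near t, forall i, P ord0 i (x s i).
  by apply: filter_forall => i; have := Pn ord0 i; rewrite mxE; exact: xc.
apply: filterS => s Ps; apply: PA => i j.
by rewrite ord1 mxE.
Qed.

End TropicalPoints.

Section PiecewiseLinear.
Variables (R : realType) (C : curve R).
Implicit Types (f : C -> R) (z : tangent C).

Lemma PL_locally_lipschitz f (s : seg C) (a : R) : is_PL f ->
  (0 <= a%:E <= seg_len s)%E -> exists d K : R, [/\ 0 < d, 0 <= K &
    forall b : R, (0 <= b%:E <= seg_len s)%E -> `|b - a| < d ->
      `|f (chart s b%:E) - f (chart s a%:E)| <= K * `|b - a|].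
Proof.
move=> fPL /andP[a0 al].
have [d1 [m1 [d10 fm1]]] : exists (d : R) (m : int), 0 < d /\ forall h, 0 <= h < d ->
    ((a + h)%:E <= seg_len s)%E ->
    f (chart s (a + h)%:E) = f (chart s a%:E) + m%:~R * h.
  have [lt|ge] := boolP (a%:E < seg_len s)%E.
    have [|m [d d0 fm]] := @PL_right_slope R C f s a fPL; first by rewrite a0.
    by exists d, m; split=> // h hd _; have := fm h hd; rewrite /along addr0.
  (* At the right end of the segment only [h = 0] is left, so radius 1 and slope 0 are placeholders;
     likewise for the left end below. *)
  exists 1, 0; split=> // h /andP[h0 _] hl.
  have -> : h = 0; last by rewrite mulr0 !addr0.
  apply/eqP; rewrite eq_le h0 andbT -(lerD2l a) addr0 -lee_fin.
  by apply: le_trans hl _; rewrite leNgt.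
have [d2 [m2 [d20 fm2]]] : exists (d : R) (m : int), 0 < d /\ forall h, 0 <= h < d ->
    0 <= a - h -> f (chart s (a - h)%:E) = f (chart s a%:E) + m%:~R * h.
  have [lt|ge] := ltP (0 : R) a.
    have [|m [d d0 fm]] := @PL_left_slope R C f s a fPL; first by rewrite lte_fin lt.
    by exists d, m; split=> // h hd _; have := fm h hd; rewrite /along subr0.
  exists 1, 0; split=> // h /andP[h0 _] ah.
  by have -> : h = 0; [lra|rewrite mulr0 subr0 addr0].
exists (Num.min d1 d2), (`|m1%:~R| + `|m2%:~R|); split.
- by rewrite lt_min d10.
- by rewrite addr_ge0.
move=> b /andP[b0 bl]; rewrite lt_min => /andP[bd1 bd2].
have [ab|ba] := leP a b.
  have h0 : 0 <= b - a by rewrite subr_ge0.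
  rewrite ger0_norm // in bd1 *.
  have := fm1 (b - a); rewrite h0 bd1 addrC subrK => /(_ isT bl) ->.
  rewrite addrC addKr normrM (ger0_norm h0) ler_wpM2r //.
  by rewrite lerDl.
have h0 : 0 <= a - b by rewrite subr_ge0 ltW.
rewrite distrC ger0_norm // in bd2.
rewrite (distrC b a) (ger0_norm h0).
have := fm2 (a - b); rewrite h0 bd2 subKr -lee_fin b0 => /(_ isT isT) ->.
rewrite addrC addKr normrM (ger0_norm h0) ler_wpM2r //.
by rewrite lerDr.
Qed.

Lemma PL_clamp_continuous f (s : seg C) (l : R) : is_PL f ->
  seg_len s = l%:E -> 0 <= l ->
  continuous (fun t => (f (chart s (clamp l%:E t)))%:E).
Proof.
move=> fPL sl l0 t0.
have cfin t : exists2 a : R, clamp l%:E t = a%:E & 0 <= a <= l.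
  have := @clamp_itv R l%:E t; rewrite lee_fin => /(_ l0).
  case: (clamp _ _) => [a| |]; rewrite ?leeNy_eq ?leye_eq ?andbF //=.
  by move=> al; exists a.
have [a ca al] := cfin t0.
have [|d [K [d0 K0 fK]]] := @PL_locally_lipschitz f s a fPL.
  by rewrite sl.
have /fine_cvg cc : clamp l%:E t @[t --> t0] --> a%:E.
  by rewrite -ca; exact: clamp_continuous.
apply: cvg_EFin; first by near=> t.
rewrite ca /=; apply/cvgrPdist_lt => e e0.
(* [K + 1] instead of [K], which may be 0. *)
have eK : 0 < Num.min d (e / (K + 1)).
  by rewrite lt_min d0 divr_gt0 // ltr_wpDl.
near=> t.
have [b cb bl] := cfin t.
have : `|a - (fine \o clamp l%:E) t| < Num.min d (e / (K + 1)).
  by near: t; move/cvgrPdist_lt: cc; exact.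
rewrite /= cb /= lt_min distrC => /andP[bd be].
rewrite distrC; apply: le_lt_trans (fK b _ bd) _; first by rewrite sl.
have : `|b - a| * (K + 1) < e by rewrite -ltr_pdivlMr // ltr_wpDl.
have := normr_ge0 (b - a); lra.
Unshelve. all: by end_near. Qed.

Lemma has_slope_eventually_lt (f g : C -> R) z (c : R) (m m' : int) :
  has_slope f z m -> has_slope g z m' -> f (along z 0) < g (along z 0) + c ->
  exists2 e : R, 0 < e & forall h, 0 <= h < e -> f (along z h) < g (along z h) + c.
Proof.
move=> [e e0 fm] [e' e'0 gm] fg.
pose K : R := `|m%:~R - m'%:~R| + 1.
have K0 : 0 < K by rewrite ltr_wpDl.
pose d := g (along z 0) + c - f (along z 0).
have d0 : 0 < d by rewrite subr_gt0.
exists (Num.min (Num.min e e') (d / K)).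
  by rewrite !lt_min e0 e'0 divr_gt0.
move=> h /andP[h0]; rewrite !lt_min => /andP[/andP[he he']].
rewrite ltr_pdivlMr // => hd.
rewrite fm ?h0 // gm ?h0 //.
have : (m%:~R - m'%:~R) * h <= `|m%:~R - m'%:~R| * h.
  by rewrite ler_wpM2r // ler_norm.
move: hd; rewrite /K /d; lra.
Qed.

End PiecewiseLinear.

(** * Slopes of parallel coordinates *)

Section ParallelSlopes.
Variables (R : realType) (C : curve R) (E : finType).
Variables (WW : set (E -> \bar R)) (F : E -> C -> R).

Definition lifts_linear_space (q : C) : Prop :=
  forall W, tilt (F ^~ q) WW W -> min_twice W.

Lemma eventually_forall (P : E -> R -> Prop) :
  (forall k, exists2 e : R, 0 < e & forall h, 0 <= h < e -> P k h) ->
  exists2 e : R, 0 < e & forall h, 0 <= h < e -> forall k, P k h.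
Proof.
move=> Pe.
suff [e e0 Ps] : exists2 e : R, 0 < e &
    forall h, 0 <= h < e -> forall k, k \in enum E -> P k h.
  by exists e => // h hh k; apply: Ps => //; rewrite mem_enum.
elim: (enum E) => [|k s [e e0 IH]]; first by exists 1.
have [e' e'0 Pk] := Pe k.
exists (Num.min e e'); first by rewrite lt_min e0.
move=> h /andP[h0]; rewrite lt_min => /andP[he he'] l; rewrite inE.
by move=> /orP[/eqP->|ls]; [apply: Pk|apply: IH] => //; rewrite h0.
Qed.

(* Where only i and j attain the minimum of a circuit, F i and F j differ by a
   constant nearby. *)
Lemma parallel_slope p i j z : circuits WW -> (forall e, is_PL (F e)) ->
  (forall q, lifts_linear_space q) -> parallel (tilt (F ^~ p) WW) i j ->
  is_tangent z -> along z 0 = p -> slope (F i) z = slope (F j) z.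
Proof.
move=> cW FPL Ftw pij zt zp.
have [->//|ij] := eqVneq i j.
have /orP[/eqP ijE|/asboolP[_ [[V WV <-] Vij Vmin]]] := pij.
  by rewrite ijE eqxx in ij.
have cW' := tilt_circuits (F ^~ p) cW.
have [a Va] : exists a : R, V i = a%:E.
  have [|b Vb] := circuits_fin_min cW' (ex_intro2 _ _ V WV erefl) (i := i).
    move=> k; have [->//|ki] := eqVneq k i; have [->|kj] := eqVneq k j.
      by rewrite Vij.
    exact/ltW/Vmin.
  by move: Vb => /=; case: (V i) => [a| |] // _; exists a.
have [b Vb] : exists b : R, V j = b%:E.
  by move: Vij; rewrite Va; case: (V j) => [b| |] // _; exists b.
have [e e0 Ve] : exists2 e : R, 0 < e & forall h, 0 <= h < e -> forall k,
    k != i -> k != j -> (V i + (F i (along z h))%:E < V k + (F k (along z h))%:E)%E.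
  apply: eventually_forall => k.
  have [->|ki] := eqVneq k i; first by exists 1.
  have [->|kj] := eqVneq k j; first by exists 1.
  have := Vmin k ki kj; have := circuits_ninfty cW WV k.
  case Vk : (V k) => [c| |] //; last by exists 1 => // h _ _ _; rewrite Va ltry.
  move=> _; rewrite Va -!EFinD lte_fin -zp => lt.
  have [|e e0 He] := has_slope_eventually_lt (c := c - a)
    (PL_has_slope (FPL i) zt) (PL_has_slope (FPL k) zt); first by lra.
  by exists e => // h /He lth _ _; rewrite lte_fin; lra.
have FE h : 0 <= h < e -> F j (along z h) = F i (along z h) + (a - b).
  move=> hh; have [c [d [cd Vcd Vc]]] :=
    Ftw (along z h) _ (ex_intro2 _ _ V WV erefl).
  have sub k : (forall l,
      (V k + (F k (along z h))%:E <= V l + (F l (along z h))%:E)%E) ->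
      k = i \/ k = j.
    move=> Vk; have [->|ki] := eqVneq k i; first by left.
    have [->|kj] := eqVneq k j; first by right.
    by have := Ve h hh k ki kj; rewrite ltNge Vk.
  have : (V i + (F i (along z h))%:E = V j + (F j (along z h))%:E)%E.
    have Vd l : (V d + (F d (along z h))%:E <= V l + (F l (along z h))%:E)%E.
      by rewrite -Vcd.
    have [ci|cj] := sub c Vc; have [di|dj] := sub d Vd.
    - by rewrite ci di eqxx in cd.
    - by rewrite -ci -dj.
    - by rewrite -cj -di.
    - by rewrite cj dj eqxx in cd.
  by rewrite Va Vb -!EFinD => -[]; lra.
apply/esym; apply: has_slope_slope.
have [e' e'0 Fm] := PL_has_slope (FPL i) zt.
exists (Num.min e e'); first by rewrite lt_min e0.
move=> h /andP[h0]; rewrite lt_min => /andP[he he'].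
rewrite !FE ?h0 ?lexx // Fm ?h0 //; lra.
Qed.

Lemma parallel_slope_sum p i j : circuits WW -> (forall e, is_PL (F e)) ->
  (forall q, lifts_linear_space q) -> parallel (tilt (F ^~ p) WW) i j ->
  slope_sum (F i) p = slope_sum (F j) p.
Proof.
move=> cW FPL Ftw pij; apply: eq_fsbigr => z /set_mem[zt zp].
exact: (@parallel_slope p).
Qed.

End ParallelSlopes.

Section Ray.
Variables (R : realType) (C : curve R) (p : C).

(* Being constant beyond T, the ray can be attached whole even when T is finite. *)
Definition ray_ext (T : \bar R) (b : bool) (f : C -> R) : attach p -> R :=
  fun q => match q with
  | inl q => f q
  | inr u => f p + b%:R * fine (Order.min (val u) T)
  end.

Variables (T : \bar R) (b : bool) (f : C -> R).
Hypothesis T_gt0 : (0 < T)%E.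

Lemma ray_ext_chart (t : R) : 0 <= t ->
  ray_ext T b f (@chart R (attach p) None t%:E) =
  f p + b%:R * fine (Order.min t%:E T).
Proof.
rewrite le_eqVlt => /predU1P[<-|t0].
  by rewrite attach_chart_le0 // min_l ?(ltW T_gt0) //= mulr0 addr0.
by rewrite attach_chart_gt0.
Qed.

Lemma ray_slope_out_lt (t : R) : 0 <= t -> (t%:E < T)%E ->
  slope (ray_ext T b f) (None, true, t) = b.
Proof.
move=> t0 tT; apply: has_slope_slope.
have [d d0 dT] : exists2 d : R, 0 < d & ((t + d)%:E <= T)%E.
  case: (T) tT => [s| |] // ts; last by exists 1; rewrite // leey.
  by exists (s - t); [rewrite subr_gt0|rewrite addrC subrK].
exists d => // h /andP[h0 hd].
have thT : ((t + h)%:E <= T)%E by apply: le_trans dT; rewrite lee_fin; lra.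
rewrite /along addr0 !ray_ext_chart ?addr_ge0 // !min_l ?(ltW tT) //=.
by case: (b) => /=; lra.
Qed.

Lemma ray_slope_out_ge (t : R) : 0 <= t -> (T <= t%:E)%E ->
  slope (ray_ext T b f) (None, true, t) = 0.
Proof.
move=> t0 tT; apply: has_slope_slope; exists 1 => // h /andP[h0 _].
rewrite /along addr0 !ray_ext_chart ?addr_ge0 // !min_r //.
  by rewrite mul0r addr0.
by apply: le_trans tT _; rewrite lee_fin lerDl.
Qed.

Lemma ray_slope_in_le (t : R) : 0 < t -> (t%:E <= T)%E ->
  slope (ray_ext T b f) (None, false, t) = - b%:R.
Proof.
move=> t0 tT; apply: has_slope_slope; exists t => // h /andP[h0 ht].
rewrite /along subr0 !ray_ext_chart ?subr_ge0 ?(ltW t0) ?(ltW ht) // !min_l //=.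
  by case: (b) => /=; lra.
by apply: le_trans tT; rewrite lee_fin; lra.
Qed.

Lemma ray_slope_in_gt (t : R) : 0 < t -> (T < t%:E)%E ->
  slope (ray_ext T b f) (None, false, t) = 0.
Proof.
case: T T_gt0 ray_ext_chart => [s| |] // s0 rE t0 tT; apply: has_slope_slope.
rewrite !lte_fin in s0 tT.
exists (t - s); rewrite ?subr_gt0 // => h /andP[h0 ht].
have th : s <= t - h by lra.
rewrite /along subr0 !rE ?(ltW t0) ?(le_trans (ltW s0) th) //.
by rewrite !min_r ?lee_fin ?(ltW tT) // mul0r addr0.
Qed.

Lemma ray_ext_PL : is_PL f -> is_PL (ray_ext T b f).
Proof.
move=> fPL [s|]; first exact: fPL.
exists (if T is s%:E then [:: s] else [::]) => a c a0 ac _ nB.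
have [cT|Tc] := leP c%:E T.
  exists (b%:Z) => t /andP[at_ tc].
  have tT : (t%:E <= T)%E by apply: le_trans cT; rewrite lee_fin.
  have aT : (a%:E <= T)%E by apply: le_trans tT; rewrite lee_fin.
  rewrite !ray_ext_chart ?(le_trans a0) // !min_l //=.
  by case: (b) => /=; lra.
have Ta : (T <= a%:E)%E.
  case: (T) T_gt0 Tc nB => [s| |] // _; rewrite lte_fin lee_fin => sc.
  move=> /(_ s); rewrite inE eqxx sc andbT => /(_ isT).
  by rewrite -leNgt.
exists 0 => t /andP[at_ tc].
rewrite !ray_ext_chart ?(le_trans a0) // !min_r //; first by rewrite mul0r addr0.
by apply: le_trans Ta _; rewrite lee_fin.
Qed.

Lemma ray_slope_sum_inl q : finite_set (tangents_at q) ->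
  slope_sum (ray_ext T b f) (inl q) =
  slope_sum f q + (if q == p then b%:Z else 0).
Proof. by move=> fin; rewrite slope_sum_inl // ray_slope_out_lt. Qed.

(** Before [T] the two slopes cancel, after [T] both vanish, and at [T] only the inward slope
    remains: the bend is the one new defect. *)
Lemma ray_slope_sum_inr (u : {t : \bar R | (0 < t)%E}) (t : R) : val u = t%:E ->
  slope_sum (ray_ext T b f) (inr u) = if val u == T then - b%:Z else 0.
Proof.
move=> ut; rewrite (slope_sum_inr _ ut) ut.
have t0 : 0 < t by rewrite -lte_fin -ut (valP u).
case: ltgtP => tT.
- by rewrite ray_slope_out_lt ?ray_slope_in_le ?(ltW t0) ?(ltW tT) // natz subrr.
- by rewrite ray_slope_out_ge ?ray_slope_in_gt ?(ltW t0) ?(ltW tT) // addr0.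
- by rewrite ray_slope_out_ge ?ray_slope_in_le ?(ltW t0) -?tT // natz add0r.
Qed.

End Ray.

(** * Metric graphs as curves *)

Section GraphCurve.
Variables (R : realType) (G : metric_graph R).

Lemma graph_at_infinity (p : G) : ~ at_infinity p.
Proof. by move=> [s []]. Qed.

Lemma graph_finite_tangents (p : G) : finite_set (tangents_at p).
Proof.
(* A direction at an inner point has the coordinate of that point as parameter; at a vertex the
   parameter is 0 or the length of the edge. *)
pose tau : R := if p is inr (existT e u) then fine (val u) else 0.
pose g (x : edge G * bool * bool) : tangent G :=
  (x.1.1, x.1.2, if x.2 then tau else len x.1.1).
apply: (@sub_finite_set _ _ (range g)); last exact: finite_image.
move=> [[s b] t] [zt zp].
have /andP[t0 tl] : (0 <= t%:E <= (len s)%:E)%E.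
  move: zt; rewrite /is_tangent.
  by case: b {zp} => /= /andP[t0 tl]; rewrite ?t0 ?tl ?(ltW t0) ?(ltW tl).
have {}zp : graph_chart s t%:E = p.
  by move: zp; rewrite /along; case: b {zt}; rewrite ?addr0 ?subr0.
suff [tE|tE] : t = tau \/ t = len s.
  by exists (s, b, true) => //; rewrite /g /= -tE.
  by exists (s, b, false) => //; rewrite /g /= -tE.
move: zp; rewrite /graph_chart; case: insubP => [u /andP[ut0 utl] uE|] pE.
  by left; rewrite /tau -pE /= uE.
move=> pE'; rewrite /tau -pE'; move: pE; rewrite negb_and -!leNgt !lee_fin.
move=> /orP[t0'|tl']; [left|right]; apply/eqP; rewrite eq_le.
  by rewrite t0' -lee_fin t0.
by rewrite tl' -lee_fin tl.
Qed.

(** Besides vertices and break points, a point has exactly two directions, with opposite slopes. The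
    list [l] makes balancing a finite induction. *)
Lemma graph_finite_defects (E : finType) (F : E -> G -> R) :
  (forall e, is_PL (F e)) ->
  exists l : seq G, forall p, p \notin l -> forall e, slope_sum (F e) p = 0.
Proof.
move=> FPL.
have /choice[B BP] (x : E * edge G) : exists B : seq R,
    forall t : R, 0 < t -> (t%:E < (len x.2)%:E)%E -> t \notin B ->
    slope (F x.1) (x.2 : seg G, false, t) = - slope (F x.1) (x.2 : seg G, true, t).
  exact: (@PL_interior_slopes R G (F x.1) x.2 (FPL x.1)).
pose A : set G := range inl `|`
  \bigcup_(x in [set: E * edge G]) (fun t : R => graph_chart x.2 t%:E) @` [set` B x].
have /finite_seqP[l lE] : finite_set A.
  rewrite finite_setU; split; first by apply: finite_image; exact: finite_finset.
  by apply: bigcup_finite => // x _; exact: finite_image.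
exists l => p pl e.
have {pl} pA : ~ A p by rewrite lE /=; exact/negP.
case: p pA => [v|[s u]] pA; first by exfalso; apply: pA; left; exists v.
case: u pA => -[t| |] ti pA; last 2 first.
- by exfalso; move: (ti) => /= /andP[_]; rewrite ltNge leey.
- by exfalso; move: (ti).
have /andP[t0 tl] : (0 < t%:E < (len s)%:E)%E := ti.
have tB : t \notin B (e, s).
  apply/negP => tB; apply: pA; right; exists (e, s) => //; exists t => //=.
  by rewrite /graph_chart insubT.
have chE t' : graph_chart s t'%:E = inr (existT _ s (exist _ t%:E ti)) -> t' = t.
  rewrite /graph_chart; case: insubP => [u _ uE|//].
  move=> /(congr1 (fun q : graph_point G =>
    if q is inr (existT _ v) then fine (val v) else 0)) /=.
  by rewrite uE.
have tE : tangents_at (inr (existT _ s (exist _ t%:E ti)) : G) =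
    [set (s : seg G, true, t)] `|` [set (s : seg G, false, t)].
  apply/seteqP; split=> [[[s' b] t'] [zt zp]|z].
    have ss' : s' = s.
      move: zp; rewrite /along /= /graph_chart; case: insubP => // u _ _.
      by move=> /(congr1 (fun q : graph_point G =>
        if q is inr v then tag v else s)).
    subst s'; have -> : t' = t.
      by apply: chE; move: zp; rewrite /along; case: (b); rewrite ?addr0 ?subr0.
    by case: (b); [left|right].
  move=> [] ->; split; rewrite /is_tangent /along ?addr0 ?subr0 /=.
  - by rewrite (ltW t0).
  - by rewrite /graph_chart insubT.
  - by rewrite (ltW tl) t0.
  - by rewrite /graph_chart insubT.
rewrite /slope_sum tE fsbigU0 ?fsbig_set1 //; last by move=> z [->].
by rewrite (BP (e, s)) //= subrr.
Qed.

End GraphCurve.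

(** * Balancing by attaching rays *)

Lemma tropical_modification_comp (R : realType) (C C' C'' : curve R)
    (i : C -> C') (j : C' -> C'') :
  tropical_modification i -> tropical_modification j ->
  tropical_modification (fun q => j (i q)).
Proof. by move=> Ci; elim=> // C3 k p _ IH pinf; exact: TM_attach. Qed.

Lemma tilt_tilt (R : realType) (E : finType) (x y : E -> R)
    (WW : set (E -> \bar R)) :
  tilt y (tilt x WW) = tilt (fun e => x e + y e) WW.
Proof.
apply/seteqP; split=> W.
  move=> [_ [V WV <-] <-]; exists V => //; apply/funext => e.
  by rewrite EFinD addeA.
move=> [V WV <-]; exists (fun e => V e + (x e)%:E)%E; first by exists V.
by apply/funext => e; rewrite EFinD addeA.
Qed.

Section Lifts.
Variables (R : realType) (n : nat).
Local Notation E := 'I_n.+1.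
Variables (WW : set (E -> \bar R)) (L : set (TP R n)).
Hypothesis cWW : circuits WW.
Hypothesis LP : forall X : E -> \bar R,
  (forall e, X e != -oo%E) -> (exists e, X e != +oo%E) ->
  (forall W, WW W -> min_twice (fun e => W e + X e)%E) ->
  L (tp_ext X).

(** Slopes are measured on the real coordinates [F], which say nothing at infinity; hence [Psi] is
    carried along separately. [L] stands for the tropical linear space, known here through [LP]. *)
Record tp_lift (C : curve R) (F : E -> C -> R) (Psi : C -> TP R n) : Prop := TpLift {
  tp_lift_tangents : forall q : C, finite_set (tangents_at q);
  tp_lift_PL : forall e, is_PL (F e);
  tp_lift_continuous : continuous Psi;
  tp_lift_E : forall q, ~ at_infinity q -> Psi q = tp_fin (F ^~ q);
  tp_lift_in : forall q, L (Psi q);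
  tp_lift_min_twice : forall q, ~ at_infinity q -> lifts_linear_space WW F q }.

(** New points get slope sum exactly 0, more than balance asks, and old ones change at [p] only, so
    extensions compose without tracking constants. *)
Record extends (C : curve R) (F : E -> C -> R) (Psi : C -> TP R n)
    (C' : curve R) (F' : E -> C' -> R) (Psi' : C' -> TP R n)
    (j : C -> C') (p : C) (u : E -> int) : Prop := Extends {
  extends_modification : tropical_modification j;
  extends_inj : injective j;
  extends_lift : tp_lift F' Psi';
  extends_F : forall e q, F' e (j q) = F e q;
  extends_Psi : forall q, Psi' (j q) = Psi q;
  extends_infinity : forall q, at_infinity (j q) <-> at_infinity q;
  extends_sum : forall e q,
    slope_sum (F' e) (j q) = slope_sum (F e) q + (if q == p then u e else 0);
  extends_new : forall q', ~ at_infinity q' -> (forall q, q' <> j q) ->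
    forall e, slope_sum (F' e) q' = 0 }.

(** Quantifying over all curves allows a second extension at the same point and an extension at the
    bend of a ray just attached; both occur below. *)
Definition addable (x : E -> R) (u : E -> int) : Prop :=
  forall (C : curve R) F Psi (p : C), @tp_lift C F Psi -> ~ at_infinity p ->
  (forall e, F e p = x e) -> exists C' F' Psi' j, @extends C F Psi C' F' Psi' j p u.

Lemma addable0 x : addable x (fun=> 0).
Proof.
move=> C F Psi p LC _ _; exists C, F, Psi, id; split=> //.
- exact: TM_id.
- by move=> e q; case: ifP; rewrite addr0.
- by move=> q' _ /(_ q').
Qed.

(** The second extension takes place at the image of [p], where the coordinates are still [x]. *)
Lemma addableD x u v : addable x u -> addable x v ->
  addable x (fun e => u e + v e).
Proof.
move=> xu xv C F Psi p LC pinf Fx.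
have [C1 [F1 [Psi1 [j1 e1]]]] := xu C F Psi p LC pinf Fx.
have [|e|C2 [F2 [Psi2 [j2 e2]]]] := xv C1 F1 Psi1 (j1 p) (extends_lift e1).
- by move=> /(extends_infinity e1).
- by rewrite (extends_F e1).
exists C2, F2, Psi2, (fun q => j2 (j1 q)); split.
- apply: tropical_modification_comp (extends_modification e2).
  exact: extends_modification e1.
- by move=> q q' /(extends_inj e2) /(extends_inj e1).
- exact: extends_lift e2.
- by move=> e q; rewrite (extends_F e2) (extends_F e1).
- by move=> q; rewrite (extends_Psi e2) (extends_Psi e1).
- by move=> q; rewrite (extends_infinity e2) (extends_infinity e1).
- move=> e q; rewrite (extends_sum e2) (extends_sum e1).
  rewrite (inj_eq (extends_inj e1)); case: ifP; rewrite -?addrA ?addr0 //.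
- move=> q2 q2inf q2new e.
  have [[q1 q12]|/forallNP q1no] := pselect (exists q1, q2 = j2 q1); last first.
    exact: (extends_new e2).
  rewrite q12 (extends_sum e2) (extends_new e1); last 2 first.
  + by rewrite -(extends_infinity e2) -q12.
  + by move=> q q1E; apply: (q2new q); rewrite q12 q1E.
  case: eqP => [q1p|_]; last by rewrite addr0.
  by exfalso; apply: (q2new p); rewrite q12 q1p.
Qed.

(** Induction on the total of [u]: subtract [1_P] for the class [P] of an index where [u] is
    positive. Only such classes have to be addable, so for [u = 1_P] at a bend only the classes
    inside [P] matter. *)
Lemma addable_classes x (u : E -> nat) :
  (forall W, tilt x WW W -> min_twice W) ->
  (forall e f, parallel (tilt x WW) e f -> u e = u f) ->
  (forall e, (0 < u e)%N ->
    addable x (fun f => (f \in par_class (tilt x WW) e)%:Z)) ->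
  addable x (fun e => (u e)%:Z).
Proof.
move=> x2; have cx := tilt_circuits x cWW.
have [m] := ubnP (\sum_e u e)%N; elim: m u => // m IH u um uc ua.
have [[e ue]|/forallNP u0] := pselect (exists e, (0 < u e)%N); last first.
  have -> : (fun e => (u e)%:Z) = fun=> 0; last exact: addable0.
  by apply/funext => e; have := u0 e; case: (u e).
pose P := par_class (tilt x WW) e.
pose v f : nat := (u f - (f \in P))%N.
have uP f : f \in P -> u f = u e.
  by rewrite inE => ef; rewrite -(uc _ _ ef).
have uv f : u f = (v f + (f \in P))%N.
  rewrite /v subnK //; case fP : (f \in P) => //.
  by rewrite (uP _ fP).
have -> : (fun f => (u f)%:Z) = fun f => (v f)%:Z + (f \in P)%:Z.
  by apply/funext => f; rewrite uv PoszD.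
have par_in f g : parallel (tilt x WW) f g -> f \in P -> g \in P.
  by rewrite !inE => fg ef; exact: parallel_trans ef fg.
apply: addableD; last exact: ua.
apply: IH.
- have eP : e \in P by rewrite inE /parallel eqxx.
  rewrite -ltnS; apply: leq_trans um; rewrite ltnS.
  rewrite (bigD1 e) //= [leqRHS](bigD1 e) //=.
  rewrite [in leqRHS](uv e) eP addn1 addSn ltnS leq_add2l.
  by apply: leq_sum => f _; rewrite [leqRHS]uv leq_addr.
- move=> f g fg; rewrite /v (uc _ _ fg); congr (_ - _)%N; congr nat_of_bool.
  by apply/idP/idP; apply: par_in; rewrite // parallel_sym.
- by move=> f vf; apply: ua; rewrite uv ltn_addr.
Qed.

Section AttachRay.
Variables (C : curve R) (F : E -> C -> R) (Psi : C -> TP R n) (p : C).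
Variables (P : {set E}) (T : \bar R).
Hypothesis LC : tp_lift F Psi.
Hypothesis p_fin : ~ at_infinity p.
Hypothesis T_gt0 : (0 < T)%E.
Hypothesis P_proper : exists e, e \notin P.
Hypothesis PT : forall t W, (0 <= t <= T)%E -> tilt (F ^~ p) WW W ->
  min_twice (push P t W).

(** An index outside of [P] keeps a finite coordinate, so even [t = +oo] gives homogeneous
    coordinates; this is the purpose of [P_proper]. *)
Definition ray_point (t : \bar R) : E -> \bar R :=
  push P (clamp T t) (fun e => (F e p)%:E).

Definition ray_F (e : E) : attach p -> R := ray_ext T (e \in P) (F e).

Definition ray_Psi : attach p -> TP R n := fun q => match q with
  | inl q => Psi q
  | inr u => tp_ext (ray_point (val u))
  end.

Lemma ray_point_fin (u : {t : \bar R | (0 < t)%E}) (t : R) e : val u = t%:E ->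
  (ray_F e (inr u))%:E = ray_point (val u) e.
Proof.
move=> ut; have t0 : (0 <= t%:E)%E by rewrite -ut ltW ?(valP u).
rewrite /ray_point /push /clamp /ray_F /= ut.
have [s -> s0] : exists2 s : R, Order.min t%:E T = s%:E & 0 <= s.
  case: (T) T_gt0 => [s| |] // s0; last by exists t; rewrite ?miney // -lee_fin.
  exists (Num.min t s); first by rewrite EFin_min.
  by rewrite le_min -!lee_fin t0 ltW.
rewrite max_r ?lee_fin //=.
by case: ifP => _; rewrite ?mul1r ?mul0r ?adde0 ?addr0.
Qed.

Lemma ray_point_min_twice t W : WW W -> min_twice (fun e => W e + ray_point t e)%E.
Proof.
move=> WWW; have := PT (clamp_itv t (ltW T_gt0)) (ex_intro2 _ _ W WWW erefl).
by congr min_twice; apply/funext => e; rewrite /ray_point /push addeA.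
Qed.

Lemma ray_point_ninfty t e : ray_point t e != -oo%E.
Proof.
rewrite /ray_point /push; case: ifP => // _.
by have := clamp_itv t (ltW T_gt0); case: (clamp T t).
Qed.

Lemma ray_point_out t e : e \notin P -> ray_point t e = (F e p)%:E.
Proof. by move=> eP; rewrite /ray_point /push (negbTE eP) adde0. Qed.

Lemma ray_point0 e : ray_point 0 e = (F e p)%:E.
Proof.
rewrite /ray_point /push clamp_id ?lexx ?ltW //.
by case: ifP; rewrite adde0.
Qed.

Lemma ray_point_continuous :
  continuous (fun t => tp_ext (ray_point t)).
Proof.
apply: tp_ext_continuous => [t i|t|i].
- exact: ray_point_ninfty.
- by have [e eP] := P_proper; exists e; rewrite ray_point_out.
- rewrite /ray_point /push => t; case: (i \in P); last exact: cvg_cst.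
  apply: cvgeD; first by case: (clamp T t).
    exact: cvg_cst.
  exact: clamp_continuous.
Qed.

Lemma ray_lift : tp_lift ray_F ray_Psi.
Proof.
split.
- by move=> q; apply: attach_finite_tangents; exact: tp_lift_tangents LC.
- by move=> e; apply: ray_ext_PL => //; exact: tp_lift_PL LC e.
- apply/continuousP => O oO; change (curve_open (ray_Psi @^-1` O)) => -[s|].
    exact: ((continuousP _).1 (tp_lift_continuous LC) O oO s).
  exists ((fun t => tp_ext (ray_point t)) @^-1` O).
    exact: ((continuousP _).1 ray_point_continuous O oO).
  (* At [t = 0] the chart returns [inl p], where [Psi] has to agree with [ray_point 0]. *)
  move=> t /andP[+ _]; rewrite le_eqVlt => /predU1P[<-|t0].
    rewrite attach_chart_le0 // /preimage /= (tp_lift_E LC) //.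
    rewrite -tp_ext_fin (_ : EFin \o _ = ray_point 0) //.
    by apply/funext => i; rewrite ray_point0.
  by rewrite attach_chart_gt0.
- move=> [q|u] qinf; rewrite /ray_Psi.
    by rewrite (tp_lift_E LC) // => /(attach_at_infinity p q).
  have [t ut t0] := attach_inr_at_infinity qinf.
  rewrite -tp_ext_fin; congr tp_ext; apply/funext => i /=.
  by rewrite -(ray_point_fin _ ut).
- move=> [q|u]; rewrite /ray_Psi; first exact: tp_lift_in LC q.
  apply: (LP (X := ray_point (val u))).
  + by move=> e; exact: ray_point_ninfty.
  + by have [e eP] := P_proper; exists e; rewrite ray_point_out.
  + by move=> W WWW; exact: ray_point_min_twice.
- move=> [q|u] qinf.
    by move=> W; apply: (tp_lift_min_twice LC) => /(attach_at_infinity p q).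
  have [t ut t0] := attach_inr_at_infinity qinf.
  move=> _ [W WWW <-].
  have := ray_point_min_twice (val u) WWW.
  by congr min_twice; apply/funext => e; rewrite -(ray_point_fin _ ut).
Qed.

End AttachRay.

Lemma addable_class x i :
  (forall W, tilt x WW W -> min_twice W) ->
  (exists e, e \notin par_class (tilt x WW) i) ->
  addable x (fun e => (e \in par_class (tilt x WW) i)%:Z).
Proof.
have [m] := ubnP #|par_class (tilt x WW) i|.
elim: m x i => // m IH x i; rewrite ltnS.
have cx := tilt_circuits x cWW.
set P := par_class (tilt x WW) i => Pm x2 P_proper C F Psi p LC p_fin Fx.
have [T [T_gt0 PT PsubT]] := ray_length i cx x2.
have FxE : F ^~ p = x by apply/funext.
have PT' t W : (0 <= t <= T)%E -> tilt (F ^~ p) WW W -> min_twice (push P t W).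
  by rewrite FxE; exact: PT.
have L1 := ray_lift LC p_fin T_gt0 P_proper PT'.
have sum_inl e q : slope_sum (ray_F (p := p) F P T e) (inl q) =
    slope_sum (F e) q + (if q == p then (e \in P)%:Z else 0).
  by apply: ray_slope_sum_inl => //; exact: tp_lift_tangents LC q.
have sum_inr e (u : {t : \bar R | (0 < t)%E}) : ~ at_infinity (inr u : attach p) ->
    slope_sum (ray_F (p := p) F P T e) (inr u) =
    if val u == T then - (e \in P)%:Z else 0.
  by move=> /attach_inr_at_infinity[t ut _]; exact: ray_slope_sum_inr ut.
case TE : T T_gt0 => [s| |] // s_gt0; last first.
  (* Here [T = +oo]: without a bend at a finite point, one ray suffices. *)
  exists (attach p), (ray_F (p := p) F P T), (ray_Psi (p := p) F Psi P T), inl.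
  split=> //.
  - by apply: (TM_attach (TM_id C)).
  - by move=> q q' [].
  - by move=> q; exact: (attach_at_infinity p q).
  - move=> [q|u] qinf qnew e; first by exfalso; apply: (qnew q).
    by rewrite sum_inr // TE; have [t -> _] := attach_inr_at_infinity qinf.
(* The bend of the ray, with slope sum [- 1_P]; adding [1_P] there by further rays makes it exactly
   0. *)
pose b : attach p := inr (exist _ s%:E s_gt0).
have b_fin : ~ at_infinity b.
  by move=> [[s'|] [_]]; rewrite ?attach_chart_gt0 => -[].
pose x' e := ray_F (p := p) F P T e b.
have x'E : tilt (fun e => if e \in P then s else 0) (tilt x WW) = tilt x' WW.
  rewrite tilt_tilt; congr tilt; apply/funext => e.
  rewrite /x' /ray_F /= Fx TE minxx /=.
  by case: ifP => _; rewrite ?mul1r ?mul0r.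
have x'2 W : tilt x' WW W -> min_twice W by exact: (tp_lift_min_twice L1 b_fin).
have sub e : e \in P -> par_class (tilt x' WW) e \proper P.
  by move=> eP; have := PsubT s e TE eP; rewrite x'E.
(* Classes at [x'] that meet [P] are strictly inside it, so [1_P] is constant on classes, and the
   induction hypothesis applies to each class involved. *)
have : addable x' (fun e => (e \in P : nat)%:Z).
  apply: addable_classes => //.
    have in_P e f : parallel (tilt x' WW) e f -> e \in P -> f \in P.
      move=> ef /sub/proper_sub/fintype.subsetP; apply.
      by rewrite inE.
    move=> e f ef; congr nat_of_bool; apply/idP/idP; apply: in_P => //.
    by rewrite parallel_sym.
  move=> e; rewrite lt0b => eP; apply: IH => //.
    by apply: leq_trans Pm; exact: proper_card (sub e eP).
  have [f fP] := P_proper; exists f; apply: contraNN fP.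
  by apply/fintype.subsetP; exact: proper_sub (sub e eP).
move=> /(_ _ _ _ b L1 b_fin (fun=> erefl)) [C2 [F2 [Psi2 [j e2]]]].
exists C2, F2, Psi2, (fun q => j (inl q)); split.
- apply: tropical_modification_comp (extends_modification e2).
  by apply: (TM_attach (TM_id C)).
- by move=> q q' /(extends_inj e2) [].
- exact: extends_lift e2.
- by move=> e q; rewrite (extends_F e2).
- by move=> q; rewrite (extends_Psi e2).
- by move=> q; rewrite (extends_infinity e2) attach_at_infinity.
- by move=> e q; rewrite (extends_sum e2) sum_inl addr0.
- move=> q2 q2inf q2new e.
  have [[q1 q12]|/forallNP q1no] := pselect (exists q1, q2 = j q1); last first.
    exact: (extends_new e2).
  have q1inf : ~ at_infinity q1 by rewrite -(extends_infinity e2) -q12.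
  rewrite q12 (extends_sum e2).
  case: q1 q12 q1inf => [q|u] q12 uinf; first by exfalso; apply: (q2new q).
  rewrite sum_inr // TE.
  have -> : (inr u == b :> attach p) = (val u == s%:E).
    apply/eqP/eqP => [[->]//|us]; rewrite /b; congr inr; exact: val_inj.
  by case: ifP => _; rewrite ?addNr ?addr0.
Qed.

(** With a single class [s] is already constant and nothing is added. Otherwise every class is
    proper, and [c - s] is added with [c] the largest absolute value of [s]. *)
Lemma addable_defect x (s : E -> int) :
  (forall W, tilt x WW W -> min_twice W) ->
  (forall e f, parallel (tilt x WW) e f -> s e = s f) ->
  exists2 u, addable x u & exists c, forall e, s e + u e = c.
Proof.
move=> x2 sc.
have [[i iP]|/forallNP proper] :=
    pselect (exists i, forall e, e \in par_class (tilt x WW) i).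
  exists (fun=> 0); first exact: addable0.
  exists (s i) => e; rewrite addr0; apply/esym/sc.
  by have := iP e; rewrite inE.
pose c := (\max_e `|s e|)%N.
have sle e : s e <= c%:Z.
  apply: le_trans (ler_norm _) _; rewrite -abszE lez_nat.
  exact: (leq_bigmax (F := fun e => `|s e|%N)).
exists (fun e => (`|c%:Z - s e|%N)%:Z).
  apply: addable_classes => //; first by move=> e f ef; rewrite (sc _ _ ef).
  move=> e _; apply: addable_class => //.
  apply: contrapT => /forallNP eP; apply: (proper e) => f.
  by apply: contrapT => /negP /(eP f).
exists c%:Z => e; rewrite abszE ger0_norm ?subr_ge0 //.
lia.
Qed.

End Lifts.

(** * Balancing the points of a metric graph *)

Section Balancing.
Variables (R : realType) (n : nat).
Local Notation E := 'I_n.+1.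
Variables (WW : set (E -> \bar R)) (L : set (TP R n)).
Hypothesis cWW : circuits WW.
Hypothesis LP : forall X : E -> \bar R,
  (forall e, X e != -oo%E) -> (exists e, X e != +oo%E) ->
  (forall W, WW W -> min_twice (fun e => W e + X e)%E) ->
  L (tp_ext X).
Variables (G : metric_graph R) (F0 : E -> G -> R).
Hypothesis F0_PL : forall e, is_PL (F0 e).
Hypothesis F0_twice : forall q, lifts_linear_space WW F0 q.

Let Psi0 : G -> TP R n := tp_map F0.

Lemma graph_lift : tp_lift WW L F0 Psi0.
Proof.
split=> //.
- exact: graph_finite_tangents.
- apply/continuousP => O oO; change (curve_open (Psi0 @^-1` O)) => s.
  exists ((fun t => tp_ext (fun i =>
      (F0 i (@chart R G s (clamp (len s)%:E t)))%:E)) @^-1` O).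
    apply: (continuousP _).1 oO; apply: tp_ext_continuous => // [t|i].
      by exists ord0.
    by apply: PL_clamp_continuous => //; exact/ltW/len_gt0.
  move=> t tl; rewrite /preimage /= clamp_id //.
  by rewrite /Psi0 /tp_map -tp_ext_fin.
- move=> q; rewrite /Psi0 /tp_map -tp_ext_fin.
  apply: (LP (X := fun e => (F0 e q)%:E)) => //.
    by exists ord0.
  by move=> W WWW; apply: (F0_twice (q := q)); exists W.
Qed.

(** Points of the graph not yet treated keep their original slope sums and coordinates, so constancy
    on parallel classes is needed on [G] only, never on the modified curve. *)
Lemma balanced_extension (l : seq G) : exists (C : curve R)
    (F : E -> C -> R) (Psi : C -> TP R n) (j : G -> C),
  [/\ tropical_modification j /\ injective j,
      tp_lift WW L F Psi /\ (forall q, Psi (j q) = Psi0 q),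
      (forall e q, F e (j q) = F0 e q) /\ (forall q, ~ at_infinity (j q)),
      forall q, q \in l \/ (forall e, slope_sum (F0 e) q = 0) ->
        exists c, forall e, slope_sum (F e) (j q) = c &
      (forall q, q \notin l ->
        forall e, slope_sum (F e) (j q) = slope_sum (F0 e) q) /\
      (forall q', ~ at_infinity q' -> (forall q, q' <> j q) ->
        forall e, slope_sum (F e) q' = 0)].
Proof.
elim: l => [|q0 l [C [F [Psi [j [[jm ji] [LC jPsi] [jF jinf] jc [jl jn]]]]]]].
  exists G, F0, Psi0, id; split=> //.
  - by split=> //; exact: TM_id.
  - by split=> //; exact: graph_lift.
  - by split=> // q; exact: graph_at_infinity.
  - by move=> q [//|q0]; exists 0.
  - by split=> // q' _ /(_ q').
(* A repeated entry is already balanced; a second extension would start from changed slope sums. *)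
have [q0l|q0l] := boolP (q0 \in l).
  exists C, F, Psi, j; split=> //.
    move=> q [ql|q0']; apply: jc; last by right.
    by left; move: ql; rewrite inE => /predU1P[->|].
  split=> // q; rewrite inE negb_or => /andP[_]; exact: jl.
have FE : F ^~ (j q0) = F0 ^~ q0 by apply/funext => e; exact: jF.
have [u addu [c uc]] : exists2 u, addable WW L (F ^~ (j q0)) u &
    exists c, forall e, slope_sum (F e) (j q0) + u e = c.
  apply: addable_defect => //; first exact: (tp_lift_min_twice LC (jinf q0)).
  move=> e f ef; rewrite !(jl _ q0l); rewrite FE in ef.
  exact: (parallel_slope_sum cWW F0_PL F0_twice ef).
have [C' [F' [Psi' [k e]]]] := addu C F Psi (j q0) LC (jinf q0) (fun=> erefl).
exists C', F', Psi', (fun q => k (j q)).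
have kj q e1 : q != q0 -> slope_sum (F' e1) (k (j q)) = slope_sum (F e1) (j q).
  by move=> qq0; rewrite (extends_sum e) (inj_eq ji) (negbTE qq0) addr0.
split.
- split; first exact: tropical_modification_comp jm (extends_modification e).
  by move=> q q' /(extends_inj e) /ji.
- split; first exact: extends_lift e.
  by move=> q; rewrite (extends_Psi e).
- split; first by move=> e1 q; rewrite (extends_F e).
  by move=> q; rewrite (extends_infinity e).
- move=> q qc; have [->|qq0] := eqVneq q q0.
    by exists c => e1; rewrite (extends_sum e) eqxx.
  have [|c' c'E] := jc q; last by exists c' => e1; rewrite kj.
  by case: qc => [|?]; [rewrite inE (negbTE qq0); left|right].
- split=> [q|q2 q2inf q2new e1].
    rewrite inE negb_or => /andP[qq0 ql] e1; rewrite kj //; exact: jl.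
  have [[q1 q12]|/forallNP q1no] := pselect (exists q1, q2 = k q1); last first.
    exact: (extends_new e).
  have q1inf : ~ at_infinity q1 by rewrite -(extends_infinity e) -q12.
  rewrite q12 (extends_sum e) jn //; last first.
    by move=> q q1E; apply: (q2new q); rewrite q12 q1E.
  case: eqP => [q1E|]; last by rewrite addr0.
  by exfalso; apply: (q2new q0); rewrite q12 q1E.
Qed.

Lemma exists_balanced_extension : exists (C : curve R) (j : G -> C)
    (Psi : C -> TP R n),
  [/\ tropical_modification j, balanced Psi, forall p, L (Psi p) &
      forall p, Psi (j p) = tp_map F0 p].
Proof.
have [l lP] := graph_finite_defects F0_PL.
have [C [F [Psi [j [[jm ji] [LC jPsi] _ jc [_ jn]]]]]] := balanced_extension l.
exists C, j, Psi; split=> //; last exact: (tp_lift_in LC).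
split; first exact: (tp_lift_continuous LC).
exists F; split.
- by move=> i; exact: (tp_lift_PL LC).
- exact: (tp_lift_E LC).
move=> p pinf; have [[q ->]|/forallNP pj] := pselect (exists q, p = j q).
  have [|c cE] := jc q; last by exists c => i.
  by have [ql|ql] := boolP (q \in l); [left|right=> e; exact: lP].
by exists 0 => i; apply: jn.
Qed.

End Balancing.

(** * From the valuated matroid to circuits on the indices *)

Section CircuitsOfMatroid.
Variables (R : realType) (n : nat) (T : Type) (phi : 'I_n.+1 -> T).
Variable M : set (T -> \bar R).

(* Indices with the same phi i are not identified: the circuit axioms hold on the
   index set all the same. *)
Definition index_circuits : set ('I_n.+1 -> \bar R) := [set V \o phi | V in M].

(** Supports lie in the range of [phi], so [V \o phi] still determines whether one support is
    contained in another. *)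
Lemma matroid_circuits rho : valuated_matroid (range phi) rho M ->
  circuits index_circuits.
Proof.
move=> vm.
have off V t : M V -> V t != +oo%E -> exists e, t = phi e.
  by move=> MV Vt; have [i _ <-] := vm_ground vm MV Vt; exists i.
have supp_phi V W : M V -> supp (V \o phi) `<=` supp (W \o phi) ->
    supp V `<=` supp W.
  move=> MV VW t Vt; have [e te] := off V t MV Vt.
  by rewrite te; apply: (VW e); rewrite /supp /= -te.
split.
- by move=> _ [V MV <-] e; exact: (vm_range vm MV).
- move=> [V MV VE]; apply: (vm_proper vm).
  suff <- : V = cst +oo%E by [].
  apply/funext => t /=; apply/eqP; apply: contrapT => /negP /[dup] Vt.
  move=> /(off V t MV)[e te]; have := congr1 (@^~ e) VE.
  by move: Vt; rewrite te /= => /eqP.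
- move=> _ a [V MV <-]; exists (fun t => V t + a%:E)%E => //.
  exact: (vm_shift vm a MV).
- move=> _ _ [V MV <-] [W MW <-] VW sVW.
  apply: (vm_incomparable vm MV MW); last exact: supp_phi sVW.
  move=> sE; apply: VW; apply/seteqP; split=> e; rewrite /supp /= => He.
    by have : supp V (phi e) by []; rewrite sE.
  by have : supp W (phi e) by []; rewrite -sE.
- move=> _ _ e e' [V MV <-] [W MW <-] /= VWe Ve VWe'.
  have [U [MU Ue Ue' UVW]] := vm_elimination vm MV MW VWe Ve VWe'.
  exists (U \o phi); split=> //; first by exists U.
  by move=> x /=; rewrite -ge_min.
Qed.

(** Any two representatives of a class differ by a real constant, which shifts all terms of a
    circuit alike. *)
Lemma min_twice_trop_linear_space (X : 'I_n.+1 -> \bar R) :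
  (forall e, X e != -oo%E) -> (exists e, X e != +oo%E) ->
  (forall W, index_circuits W -> min_twice (fun e => W e + X e)%E) ->
  trop_linear_space phi M (tp_ext X).
Proof.
move=> XN Xy X2 x xE V MV /=.
have [c xc] : exists c : R, forall i, (val x ord0 i = X i + c%:E)%E.
  move: xE; rewrite /tp_ext /tp_class => /esym /eqmodP /asboolP[c cE].
  by exists c => i; rewrite cE val_insubd tp_ext_val // mxE.
have [i [j [ij VX Vmin]]] := X2 _ (ex_intro2 _ _ V MV erefl).
exists i, j; split=> //.
- by rewrite !xc !addeA; congr (_ + _)%E; exact: VX.
- by move=> k; rewrite !xc !addeA leeD2rE //; exact: Vmin.
Qed.

End CircuitsOfMatroid.

Lemma dependences_min_twice (R : realType) (C : curve R) (n : nat)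
    (phi : 'I_n.+1 -> C -> R) (M : set ((C -> R) -> \bar R)) :
  (forall V f, M V -> V f != -oo%E) ->
  (forall V, M V -> supp V `<=` range phi) -> gives_dependences M ->
  forall q, lifts_linear_space (index_circuits phi M) phi q.
Proof.
move=> MN Mphi dM q _ [_ [V MV <-] <-].
have [f [g [Vf Vg fg fgE fmin]]] := dM V MV q.
have [e _ ef] := Mphi V MV f Vf; have [e' _ eg] := Mphi V MV g Vg.
have Vfin k : supp V k -> V k = (fine (V k))%:E.
  by move=> Vk; rewrite fineK // fin_numE MN.
exists e, e'; split=> /=.
- by apply/eqP => ee'; apply: fg; rewrite -ef -eg ee'.
- by rewrite ef eg (Vfin f Vf) (Vfin g Vg) -!EFinD addrC fgE addrC.
- move=> k; rewrite ef (Vfin f Vf); have [Vk|Vk] := eqVneq (V (phi k)) +oo%E.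
    by rewrite Vk leey.
  rewrite (Vfin _ Vk) -!EFinD lee_fin addrC [leRHS]addrC.
  exact: fmin.
Qed.

Theorem proposition5p8 (R : realType) (G : metric_graph R) (D : divisor G)
    (r n : nat) (Sigma : set (G -> R)) (phi : 'I_n.+1 -> G -> R)
    (M : set ((G -> R) -> \bar R)) :
  is_divisor D ->
  strong_tropical_linear_series D r Sigma ->
  Sigma = trop_span (range phi) ->
  valuated_matroid (range phi) r.+1 M ->
  gives_dependences M ->
  exists (G' : curve R) (iota : G -> G') (Phi' : G' -> TP R n),
    [/\ tropical_modification iota,
        balanced Phi',
        forall p, trop_linear_space phi M (Phi' p) &
        forall p, Phi' (iota p) = tp_map phi p].
Proof.
move=> _ [tls _ _ _] SigmaE vm dM.
have phi_PL i : is_PL (phi i).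
  case: tls SigmaE => r' S [SPL _] _ _ _ _ SE; apply: SPL; rewrite SE.
  (* [phi i] is a combination with a single term, hence lies in [Sigma] and is piecewise linear. *)
  exists 0%N, (fun=> phi i), (fun=> 0); split; first by move=> _; exists i.
  by apply/funext => p; rewrite /trop_comb big_ord_recl big_ord0 minxx addr0.
have phi_twice := dependences_min_twice
  (fun V f MV => vm_range vm MV f) (fun V MV => vm_ground vm MV) dM.
have [C [j [Psi [jm bal Lin jE]]]] := exists_balanced_extension
  (matroid_circuits vm) (@min_twice_trop_linear_space _ _ _ phi M)
  phi_PL phi_twice.
by exists C, j, Psi.
Qed.
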